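(* For every $\gamma,\delta\in(0,1)$ there are integers $N=N(\gamma,\delta)$ and $T=T(\gamma,\delta)$ such that the following holds. If $G$ is a graph on $n\ge N$ vertices whose triangle density is $d_{K_3}(G)=\gamma$, then there is an integer $t$ with $2\le t\le T$ such that the $K_{t,t,t}$-density of $G$ satisfies $d_{K_{t,t,t}}(G)\ge \gamma^{(1+\delta)t^2}$.
   Context: Graphs are finite and simple. For a fixed graph $H$ on $h$ vertices and a graph $G$ on $n$ vertices, $Hom_H(G)$ is the number of homomorphisms from $H$ to $G$, i.e. (not necessarily injective) mappings $V(H)\to V(G)$ which map edges of $H$ to edges of $G$. The $H$-density of $G$ is $d_H(G)=Hom_H(G)/n^h$. The triangle density is the $K_3$-density. $K_{t,t,t}$ is the complete 3-partite graph with three parts of size $t$ (the $t$-blowup of the triangle). *)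

(* Defs.v *)
From HB Require Import structures.
From mathcomp Require Import all_boot all_order all_algebra.
From mathcomp Require Import reals exp.

Set Implicit Arguments.
Unset Strict Implicit.
Unset Printing Implicit Defensive.

Import Order.TTheory GRing.Theory Num.Theory.

Local Open Scope ring_scope.

Record sgraph := SGraph {
  vertex :> finType;
  edge : rel vertex;
  edge_sym : symmetric edge;
  edge_irr : irreflexive edge }.

Definition is_hom (H G : sgraph) (f : {ffun H -> G}) : bool :=
  [forall x, forall y, edge x y ==> edge (f x) (f y)].

Definition hom_count (H G : sgraph) : nat :=
  #|[set f : {ffun H -> G} | is_hom f]|.

Definition density (R : realType) (H G : sgraph) : R :=
  (hom_count H G)%:R / (#|G| ^ #|H|)%:R.

Fact neq_on_sym (V : Type) (C : eqType) (c : V -> C) :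
  symmetric (fun x y : V => c x != c y).
Proof. by move=> x y /=; rewrite eq_sym. Qed.

Fact neq_on_irr (V : Type) (C : eqType) (c : V -> C) :
  irreflexive (fun x y : V => c x != c y).
Proof. by move=> x /=; rewrite eqxx. Qed.

Definition complete_graph (n : nat) : sgraph :=
  SGraph (@neq_on_sym 'I_n 'I_n id) (@neq_on_irr 'I_n 'I_n id).

(* The vertex (i, j) is the j-th vertex of the i-th of r parts of size t. *)
Definition complete_multipartite (r t : nat) : sgraph :=
  SGraph (@neq_on_sym ('I_r * 'I_t)%type 'I_r fst)
         (@neq_on_irr ('I_r * 'I_t)%type 'I_r fst).

(* Main.v *)
(* Pass to a tripartite piece of [G] that looks quasirandom up to rare defects,
   then grow a blowup inside it.

   Two nested partitions of the vertex set come from a strong regularity lemma: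
   the fine one is cut-regular to a precision chosen as a function of the size of
   the coarse one, but refining barely changes the densities in [L^2]. By averaging
   there are three coarse blocks with product of pair densities at least about
   [gamma], on whose pairs the fine density [W'] is rarely much smaller than the
   coarse one. If [t] is large compared with the number of coarse blocks, the
   volume of the blocks costs only [gamma ^ (o(1) t^2)], and counting with [W']
   instead of [G] is harmless. So it is enough to find many copies of [K_{t,t,t}]
   all of whose pairs are good, in a tripartite graph of good pairs that misses a
   small but fixed proportion of the edges.

   For this, choose the vertices [x_1, ..., x_t] of the first part one at a time and
   follow a rectangle [Y * Z] of common neighbours, minimizing the potential
   [bad (Y, Z) - lam * ln (|Y| |Z|)] over subrectangles before each choice. In a
   minimizer every subrectangle has almost as many bad pairs as it should, hence
   removing the few non-neighbours of a typical [x] raises the potential by only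
   [O(tau * lam)]. With [lam] of order [1 / t] the final rectangle is nearly complete and has
   relative area [exp (- O(tau t))]; Sidorenko's inequality for [K_{t,t}] finishes. *)

Require Import Defs.
From HB Require Import structures.
From mathcomp Require Import all_boot all_order all_algebra.
From mathcomp Require Import reals exp.
From mathcomp Require Import ring lra zify.

Set Implicit Arguments.
Unset Strict Implicit.
Unset Printing Implicit Defensive.

Import Order.TTheory GRing.Theory Num.Theory.

Local Open Scope ring_scope.

(** * Regular partitions *)

Section ConditionalExpectation.
Variables (R : realFieldType) (U : finType).
Implicit Types f g h : U -> R.

Definition cond_exp (K : eqType) (k : U -> K) f (p : U) : R :=
  (\sum_(q | k q == k p) f q) / #|[pred q | k q == k p]|%:R.

(** The squared [L^2] norm of the averaged function, taken with counting measure. *)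
Definition energy (K : eqType) (k : U -> K) f : R :=
  \sum_p cond_exp k f p ^+ 2.

Lemma card_fiber_gt0 (K : eqType) (k : U -> K) p :
  0 < #|[pred q | k q == k p]|%:R :> R.
Proof. by rewrite ltr0n; apply/card_gt0P; exists p; rewrite inE. Qed.

Lemma cond_exp_const (K : eqType) (k : U -> K) f p q :
  k p = k q -> cond_exp k f p = cond_exp k f q.
Proof. by rewrite /cond_exp => ->. Qed.

(** Averaging is self-adjoint and fixes functions constant on fibres: after exchanging the sums,
    each [q] is counted once for every [p] in its fibre, which cancels the denominator. *)
Lemma sum_cond_exp_mul (K : eqType) (k : U -> K) f h :
  (forall p q, k p = k q -> h p = h q) ->
  \sum_p cond_exp k f p * h p = \sum_p f p * h p.
Proof.
move=> hk; transitivity (\sum_p \sum_(q | k q == k p)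
    f q * h q / #|[pred z | k z == k q]|%:R).
  apply: eq_bigr => p _; rewrite /cond_exp mulrAC mulr_suml mulr_suml.
  by apply: eq_bigr => q /eqP kqp; rewrite (hk _ _ kqp) kqp.
rewrite (exchange_big_dep xpredT) //=; apply: eq_bigr => q _.
under eq_bigl => p do rewrite eq_sym.
rewrite sumr_const -[LHS]mulr_natr -mulrA mulVf ?mulr1 //.
by rewrite gt_eqF // card_fiber_gt0.
Qed.

Lemma sum_cond_exp (K : eqType) (k : U -> K) f :
  \sum_p cond_exp k f p = \sum_p f p.
Proof.
rewrite -[LHS](eq_bigr _ (fun p _ => mulr1 _)).
by rewrite (@sum_cond_exp_mul _ _ _ (fun=> 1)) //; under eq_bigr do rewrite mulr1.
Qed.

Lemma cond_exp_le (K : eqType) (k : U -> K) f g p :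
  (forall q, f q <= g q) -> cond_exp k f p <= cond_exp k g p.
Proof.
by move=> fg; rewrite ler_pM2r ?ler_sum // invr_gt0 card_fiber_gt0.
Qed.

Lemma cond_exp_cst (K : eqType) (k : U -> K) (a : R) p :
  cond_exp k (fun=> a) p = a.
Proof.
rewrite /cond_exp sumr_const -[in X in X / _]mulr_natr mulfK //.
by rewrite gt_eqF // card_fiber_gt0.
Qed.

Lemma cond_exp_bounds (K : eqType) (k : U -> K) f p :
  (forall q, 0 <= f q <= 1) -> 0 <= cond_exp k f p <= 1.
Proof.
move=> f01; rewrite -{1}(cond_exp_cst k 0 p) -[X in _ && (_ <= X)](cond_exp_cst k 1 p).
by rewrite !cond_exp_le // => q; case/andP: (f01 q).
Qed.

Lemma energy_ge0 (K : eqType) (k : U -> K) f : 0 <= energy k f.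
Proof. by apply: sumr_ge0 => p _; exact: sqr_ge0. Qed.

Lemma energy_le (K : eqType) (k : U -> K) f :
  (forall q, 0 <= f q <= 1) -> energy k f <= #|U|%:R.
Proof.
move=> f01; rewrite -sum1_card natr_sum; apply: ler_sum => p _.
by case/andP: (cond_exp_bounds k p f01) => *; rewrite exprn_ile1.
Qed.

(** Pythagoras: the coarse average is the orthogonal projection of the fine one, so the cross term
    equals the coarse energy. *)
Lemma energy_refine (K1 K2 : eqType) (k1 : U -> K1) (k2 : U -> K2) f :
  (forall p q, k2 p = k2 q -> k1 p = k1 q) ->
  \sum_p (cond_exp k2 f p - cond_exp k1 f p) ^+ 2 = energy k2 f - energy k1 f.
Proof.
move=> k12; have cross : \sum_p cond_exp k2 f p * cond_exp k1 f p = energy k1 f.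
  rewrite sum_cond_exp_mul => [|p q /k12/cond_exp_const//].
  by rewrite -(@sum_cond_exp_mul _ k1) => [//|p q /cond_exp_const].
have -> : energy k2 f - energy k1 f =
    energy k2 f - (energy k1 f) *+ 2 + energy k1 f by ring.
rewrite -[in X in X *+ 2]cross -sumrMnl -sumrB -big_split /=.
by apply: eq_bigr => p _; ring.
Qed.

Lemma cauchy_schwarz f g :
  (\sum_p f p * g p) ^+ 2 <= (\sum_p f p ^+ 2) * (\sum_p g p ^+ 2).
Proof.
set A := \sum_p f p ^+ 2; set B := \sum_p g p ^+ 2; set C := \sum_p f p * g p.
have A0 : 0 <= A by apply: sumr_ge0 => p _; exact: sqr_ge0.
have : 0 <= \sum_p (A * g p - C * f p) ^+ 2 by apply: sumr_ge0 => p _; exact: sqr_ge0.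
have -> : \sum_p (A * g p - C * f p) ^+ 2 = A * (A * B - C ^+ 2).
  transitivity (\sum_p (A ^+ 2 * g p ^+ 2 - (A * C *+ 2) * (f p * g p)
      + C ^+ 2 * f p ^+ 2)).
    by apply: eq_bigr => p _; ring.
  by rewrite big_split sumrB /= -!mulr_sumr -/A -/B -/C; ring.
have [A_eq0|A_neq0] := eqVneq A 0; last first.
  by rewrite pmulr_rge0 ?subr_ge0 // lt_neqAle eq_sym A_neq0.
have f0 p : f p = 0.
  move/eqP: A_eq0; rewrite psumr_eq0 => [|q _]; last exact: sqr_ge0.
  by move/allP/(_ p (mem_index_enum _)); rewrite sqrf_eq0 => /eqP.
have -> : C = 0 by apply: big1 => p _; rewrite f0 mul0r.
move=> _; rewrite expr2 mul0r mulr_ge0 //; apply: sumr_ge0 => p _; exact: sqr_ge0.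
Qed.

End ConditionalExpectation.

(** * Weak and strong regularity by energy increment *)

Section Regularity.
Variable R : realType.
Implicit Types V : finType.

(** Distance at most [e] in the cut norm, normalized by [#|V| ^ 2]. *)
Definition cut_close V (e : R) (f g : V * V -> R) : bool :=
  [forall S : {set V}, forall T : {set V},
    `|\sum_(x in S) \sum_(y in T) (f (x, y) - g (x, y))| <= e * #|V|%:R ^+ 2].

Definition box V (c : V -> nat) (p : V * V) : nat * nat := (c p.1, c p.2).

Lemma sum_rect V (S T : {set V}) (F : V -> V -> R) :
  \sum_(x in S) \sum_(y in T) F x y =
  \sum_p F p.1 p.2 * ((p.1 \in S) && (p.2 \in T))%:R.
Proof.
rewrite pair_big /= [LHS]big_mkcond; apply: eq_bigr => p _.
by case: ifP; rewrite (mulr1, mulr0).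
Qed.

(** If sets [S], [T] witness irregularity, splitting every block along both correlates the change of
    the averaged density with the indicator of [S * T]; Cauchy-Schwarz turns this into an energy
    gain. *)
Lemma regularity_step V (e : R) (w : V * V -> R) (c : V -> nat) m :
  0 <= e -> (0 < #|V|)%N -> (forall x, (c x < m)%N) ->
  exists c' : V -> nat, [/\ forall x, (c' x < m * 4)%N,
    forall x y, c' x = c' y -> c x = c y &
    cut_close e w (cond_exp (box c') w) \/
    energy (box c) w + e ^+ 2 * #|V|%:R ^+ 2 <= energy (box c') w].
Proof.
move=> e0 V0 cm; have [reg|] := boolP (cut_close e w (cond_exp (box c) w)).
  by exists c; split=> // [x|]; [have := cm x; lia | left].
rewrite negb_forall => /existsP[S]; rewrite negb_forall => /existsP[T].
rewrite -ltNge => irr.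
(* The old label and the two membership bits, packed as one number. *)
pose c' x := (c x * 4 + (x \in S) * 2 + (x \in T))%N.
have c'E x y : c' x = c' y -> [/\ c x = c y, (x \in S) = (y \in S) & (x \in T) = (y \in T)].
  by rewrite /c'; do 4![case: (_ \in _)]; rewrite /=; split=> //; lia.
exists c'; split=> [x|x y /c'E[]//|].
  by rewrite /c'; have := cm x; do 2![case: (_ \in _)] => /=; lia.
right; pose h (p : V * V) : R := ((p.1 \in S) && (p.2 \in T))%:R.
set n : R := #|V|%:R in irr *.
have hc' p q : box c' p = box c' q -> h p = h q.
  by case=> /c'E[_ h1 _] /c'E[_ _ h2]; rewrite /h h1 h2.
have ref p q : box c' p = box c' q -> box c p = box c q.
  by case=> /c'E[h1 _ _] /c'E[h2 _ _]; rewrite /box h1 h2.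
pose D p := cond_exp (box c') w p - cond_exp (box c) w p.
(* [S * T] is a union of boxes of [c'], so on it the refined average has the same sum as [w]. *)
have irr' : e * n ^+ 2 < `|\sum_p D p * h p|.
  suff -> : \sum_p D p * h p = \sum_(x in S) \sum_(y in T)
      (w (x, y) - cond_exp (box c) w (x, y)) by [].
  rewrite sum_rect.
  under eq_bigr do rewrite mulrBl.
  under [RHS]eq_bigr do rewrite mulrBl.
  rewrite !sumrB (sum_cond_exp_mul _ hc'); congr (_ - _);
    by apply: eq_bigr => -[].
have := cauchy_schwarz D h.
rewrite energy_refine // -real_normK ?num_real // => CS.
have hn : \sum_p h p ^+ 2 <= n ^+ 2.
  rewrite /n -natrX -mulnn -card_prod -sum1_card natr_sum.
  by apply: ler_sum => p _; rewrite /h; case: (_ && _); rewrite ?expr1n ?expr0n.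
have n_gt0 : 0 < n by rewrite ltr0n.
have /lt_le_trans/(_ CS) : (e * n ^+ 2) ^+ 2 < `|\sum_p D p * h p| ^+ 2.
  by rewrite ltr_pXn2r // nnegrE ?mulr_ge0 // exprn_ge0 // ltW.
have E0 : 0 <= energy (box c') w - energy (box c) w.
  by rewrite -energy_refine //; apply: sumr_ge0 => p _; exact: sqr_ge0.
move=> /lt_le_trans/(_ (ler_wpM2l E0 hn)).
rewrite exprMn -exprM [n ^+ (_ * _)](exprM n 2 2) expr2 mulrA.
by rewrite ltr_pM2r ?exprn_gt0 //; lra.
Qed.

Lemma regularity_iter V (e : R) (w : V * V -> R) (c : V -> nat) m J :
  0 <= e -> (0 < #|V|)%N -> (forall x, (c x < m)%N) ->
  exists c' : V -> nat, [/\ forall x, (c' x < m * 4 ^ J)%N,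
    forall x y, c' x = c' y -> c x = c y &
    cut_close e w (cond_exp (box c') w) \/
    energy (box c) w + J%:R * e ^+ 2 * #|V|%:R ^+ 2 <= energy (box c') w].
Proof.
move=> e0 V0 cm; elim: J => [|J [c1 [c1m ref1 [reg|en]]]].
- by exists c; split=> [x||]; rewrite ?muln1 //; right; rewrite !mul0r addr0.
- exists c1; split=> // [x|]; [|by left].
  by apply: leq_trans (c1m x) _; rewrite leq_mul2l leq_exp2l ?leqnSn ?orbT.
- have [c2 [c2m ref2 alt]] := regularity_step w e0 V0 c1m.
  exists c2; split=> [x|x y /ref2/ref1//|].
    by rewrite expnS mulnCA -mulnC mulnC; move: (c2m x); rewrite mulnC.
  case: alt => [|en2]; [by left | right].
  rewrite -natr1; apply: le_trans en2; lra.
Qed.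

Lemma weak_regularity (e : R) m : 0 < e -> exists M : nat,
  forall V (w : V * V -> R) (c : V -> nat),
  (0 < #|V|)%N -> (forall p, 0 <= w p <= 1) -> (forall x, (c x < m)%N) ->
  exists c' : V -> nat, [/\ forall x, (c' x < M)%N,
    forall x y, c' x = c' y -> c x = c y &
    cut_close e w (cond_exp (box c') w)].
Proof.
(* More than [e ^- 2] energy gains would exceed the maximal energy [#|V| ^ 2]. *)
move=> e0; pose J := (Num.truncn (e ^- 2)).+1.
have J1 : 1 < J%:R * e ^+ 2.
  by rewrite -ltr_pdivrMr ?exprn_gt0 // div1r /J truncnS_gt.
exists (m * 4 ^ J)%N => V w c V0 w01 cm.
have [c' [c'm ref [reg|en]]] := regularity_iter w J (ltW e0) V0 cm.
  by exists c'.
have := le_trans en (energy_le (box c') w01).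
rewrite card_prod natrM -expr2 => le1.
have n0 : 0 < #|V|%:R ^+ 2 :> R by rewrite exprn_gt0 // ltr0n.
have := energy_ge0 (box c) w.
by move: J1; rewrite -(ltr_pM2r n0) mul1r; lra.
Qed.

(* The fine partition is regular to a precision depending on the size of the
   coarse one, yet its density function is [L^2]-close to the coarse one. *)
Lemma strong_regularity (zeta : R) (e : nat -> R) :
  0 < zeta -> (forall m, 0 < e m) -> exists M : nat,
  forall V (w : V * V -> R), (0 < #|V|)%N -> (forall p, 0 <= w p <= 1) ->
  exists m (c c' : V -> nat),
  [/\ (m <= M)%N, forall x, (c x < m)%N, forall x y, c' x = c' y -> c x = c y,
    cut_close (e m) w (cond_exp (box c') w) &
    energy (box c') w <= energy (box c) w + zeta * #|V|%:R ^+ 2].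
Proof.
(* Apply weak regularity with precision [e m] to a partition with [m] labels: stop if the energy
   gain is at most [zeta], otherwise repeat. After [K] failures the energy has grown by [K * zeta].
   The bound [M] is chosen before the graph, hence the induction over all [m]. *)
move=> z0 e0; suff iter K m : exists M : nat,
    forall V (w : V * V -> R) (c : V -> nat),
    (0 < #|V|)%N -> (forall p, 0 <= w p <= 1) -> (forall x, (c x < m)%N) ->
    (exists m (c c' : V -> nat),
    [/\ (m <= M)%N, forall x, (c x < m)%N, forall x y, c' x = c' y -> c x = c y,
      cut_close (e m) w (cond_exp (box c') w) &
      energy (box c') w <= energy (box c) w + zeta * #|V|%:R ^+ 2]) \/
    (exists c' : V -> nat,
      energy (box c) w + K%:R * zeta * #|V|%:R ^+ 2 <= energy (box c') w).
  pose K := (Num.truncn zeta^-1).+1.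
  have K1 : 1 < K%:R * zeta by rewrite -ltr_pdivrMr // div1r /K truncnS_gt.
  have [M HM] := iter K 1%N; exists M => V w V0 w01.
  have [//|[c' en]] := HM V w (fun=> 0%N) V0 w01 (fun=> erefl).
  have := le_trans en (energy_le (box c') w01).
  rewrite card_prod natrM -expr2 => le1.
  have n0 : 0 < #|V|%:R ^+ 2 :> R by rewrite exprn_gt0 // ltr0n.
  have := energy_ge0 (box (fun _ : V => 0%N)) w.
  by move: K1; rewrite -(ltr_pM2r n0) mul1r; lra.
elim: K m => [|K IH] m.
  by exists 0%N => V w c _ _ _; right; exists c; rewrite !mul0r addr0.
have [M1 HM1] := weak_regularity m (e0 m).
have [M2 HM2] := IH M1; exists (maxn m M2) => V w c V0 w01 cm.
have [c1 [c1m ref reg]] := HM1 V w c V0 w01 cm.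
have [en|/ltW en] := leP (energy (box c1) w) (energy (box c) w + zeta * #|V|%:R ^+ 2).
  by left; exists m, c, c1; split=> //; rewrite leq_maxl.
have [[m' [c' [c'' [m'M]]]]|[c' en']] := HM2 V w c1 V0 w01 c1m.
  by left; exists m', c', c''; split=> //; rewrite leq_max m'M orbT.
by right; exists c'; apply: le_trans en'; rewrite -natr1; lra.
Qed.

End Regularity.

(** * Counting lemma *)

Section Counting.
Variables (R : realType) (V H : finType).
Implicit Types (F G : V * V -> R) (f : {ffun H -> V}) (e : rel H).

(* [e] lists every edge of [H] in one direction only. *)
Definition hom_sum e F : R :=
  \sum_(f : {ffun H -> V}) \prod_(p : H * H | e p.1 p.2) F (f p.1, f p.2).

(** The form is linear in [a] and in [b], so it is largest at indicators: first round [a] to the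
    rows with nonnegative weighted sum, then [b] to the columns with nonnegative sum over these
    rows. *)
Lemma bilinear_cut_bound (D : V -> V -> R) (K : R) (a b : V -> R) :
  (forall S T : {set V}, \sum_(x in S) \sum_(y in T) D x y <= K) ->
  (forall x, 0 <= a x <= 1) -> (forall x, 0 <= b x <= 1) ->
  \sum_x \sum_y D x y * (a x * b y) <= K.
Proof.
move=> DK a01 b01.
have le_pos (c d : V -> R) : (forall x, 0 <= d x <= 1) ->
    \sum_x c x * d x <= \sum_(x in [set x | 0 <= c x]) c x.
  move=> d01; rewrite [leRHS]big_mkcond; apply: ler_sum => x _; rewrite inE.
  by have := d01 x; case: (lerP 0 (c x)); nra.
pose S := [set x | 0 <= \sum_y D x y * b y].
pose T := [set y | 0 <= \sum_(x in S) D x y].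
apply: le_trans (DK S T); rewrite [leRHS]exchange_big /=.
apply: le_trans (le_pos (fun y => \sum_(x in S) D x y) b b01).
have -> : \sum_y (\sum_(x in S) D x y) * b y = \sum_(x in S) \sum_y D x y * b y.
  by rewrite exchange_big; apply: eq_bigr => y _; rewrite mulr_suml.
apply: le_trans (le_pos (fun x => \sum_y D x y * b y) a a01).
by apply: ler_sum => x _; rewrite mulr_suml; apply: ler_sum => y _; lra.
Qed.

Definition upd f (i : H) (u : V) : {ffun H -> V} :=
  [ffun j => if j == i then u else f j].

(** Swapping the new value [u] with the old value [f i] is an involution on pairs [(f, u)]. *)
Lemma sum_upd (Q : {ffun H -> V} -> R) i :
  \sum_f \sum_u Q (upd f i u) = #|V|%:R * \sum_f Q f.
Proof.
pose phi (p : {ffun H -> V} * V) := (upd p.1 i p.2, p.1 i).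
have phiK : involutive phi.
  case=> f u; rewrite /phi /= /upd ffunE eqxx; congr pair.
  by apply/ffunP => j; rewrite !ffunE; case: eqP => [->|].
rewrite pair_big /= (reindex_inj (inv_inj phiK)) /=.
transitivity (\sum_(p : {ffun H -> V} * V) Q p.1).
  by apply: eq_bigr => -[f u] _; have := phiK (f, u); rewrite {1}/phi => -[->].
rewrite mulr_sumr -(pair_bigA _ (fun f (u : V) => Q f)) /=.
by apply: eq_bigr => f _; rewrite sumr_const mulr_natl.
Qed.

Lemma prod_bounds (I : Type) (s : seq I) (P : pred I) (Q : I -> R) :
  (forall q, 0 <= Q q <= 1) -> 0 <= \prod_(q <- s | P q) Q q <= 1.
Proof.
move=> Q01; elim/big_ind: _ => [|x y|//]; first by rewrite ler01 lexx.
by move=> /andP[x0 x1] /andP[y0 y1]; rewrite mulr_ge0 // mulr_ile1.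
Qed.

Definition touches (i : H) (q : H * H) := (q.1 == i) || (q.2 == i).

Lemma prod_upd (s : seq (H * H)) (P : pred (H * H)) F f i u :
  (forall q, q \in s -> P q -> ~~ touches i q) ->
  \prod_(q <- s | P q) F (upd f i u q.1, upd f i u q.2) =
  \prod_(q <- s | P q) F (f q.1, f q.2).
Proof.
move=> sP; rewrite big_seq_cond [RHS]big_seq_cond.
apply: eq_bigr => q /andP[qs /(sP _ qs)]; rewrite negb_or => /andP[q1 q2].
by rewrite !ffunE (negPf q1) (negPf q2).
Qed.

Lemma upd_comm f i j u v : i != j -> upd (upd f i u) j v = upd (upd f j v) i u.
Proof.
move=> ij; apply/ffunP => k; rewrite !ffunE.
by case: (k =P j) => // ->; rewrite eq_sym (negPf ij).
Qed.

(* With all coordinates but [i] and [j] frozen, every other factor depends on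
   at most one of [f i], [f j]. *)
Lemma hom_sum_edge (eps : R) F G i j (A B : {ffun H -> V} -> R) :
  (0 < #|V|)%N -> cut_close eps F G -> i != j ->
  (forall f, 0 <= A f <= 1) -> (forall f, 0 <= B f <= 1) ->
  (forall f v, A (upd f j v) = A f) -> (forall f u, B (upd f i u) = B f) ->
  \sum_(f : {ffun H -> V}) (F (f i, f j) - G (f i, f j)) * (A f * B f) <= eps * #|V|%:R ^+ #|H|.
Proof.
move=> V0 /forallP cut ij A01 B01 Aj Bi.
have n0 : 0 < #|V|%:R ^+ 2 :> R by rewrite exprn_gt0 // ltr0n.
pose Q (f : {ffun H -> V}) := (F (f i, f j) - G (f i, f j)) * (A f * B f).
(* Resample coordinates [i] and [j], at the price of a factor [#|V| ^ 2]; it then suffices to bound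
   the inner double sum for each fixed [f]. *)
rewrite -(ler_pM2l n0) expr2 -mulrA -!(sum_upd Q j).
rewrite -(sum_upd (fun f => \sum_v Q (upd f j v)) i).
have -> : #|V|%:R * #|V|%:R * (eps * #|V|%:R ^+ #|H|) =
    \sum_(f : {ffun H -> V}) eps * #|V|%:R ^+ 2.
  by rewrite sumr_const card_ffun -[RHS]mulr_natr natrX; ring.
apply: ler_sum => f _.
have -> : \sum_u \sum_v Q (upd (upd f i u) j v) = \sum_u \sum_v
    (F (u, v) - G (u, v)) * (A (upd f i u) * B (upd f j v)).
  apply: eq_bigr => u _; apply: eq_bigr => v _.
  rewrite /Q Aj; congr (_ * (_ * _)); last by rewrite upd_comm // Bi.
  by rewrite !ffunE eqxx (negPf ij) eqxx.
apply: bilinear_cut_bound => // S T.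
exact: le_trans (ler_norm _) (forallP (cut S) T).
Qed.

(** Edges of [Y] pass from [F] to [G] one at a time, each at the cost given by [hom_sum_edge]. The
    last hypothesis excludes loops and edges listed in both directions. *)
Lemma hom_sum_telescope (eps : R) F G (X Y : seq (H * H)) :
  (0 < #|V|)%N -> cut_close eps F G -> uniq (X ++ Y) ->
  (forall p, 0 <= F p <= 1) -> (forall p, 0 <= G p <= 1) ->
  (forall i j, (i, j) \in X ++ Y -> (j, i) \notin X ++ Y) ->
  \sum_(f : {ffun H -> V}) \prod_(q <- X) G (f q.1, f q.2) * \prod_(q <- Y) F (f q.1, f q.2) <=
  \sum_(f : {ffun H -> V}) \prod_(q <- X ++ Y) G (f q.1, f q.2) +
    (size Y)%:R * (eps * #|V|%:R ^+ #|H|).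
Proof.
move=> V0 cut + F01 G01; elim: Y X => [|[i j] Y IH] X uXY asym.
  by rewrite mul0r addr0 cats0; under eq_bigr do rewrite big_nil mulr1.
have ij : i != j.
  apply/eqP => eij; have := asym i j; rewrite eij mem_cat mem_head orbT.
  by move=> /(_ isT).
have := IH (rcons X (i, j)); rewrite cat_rcons => /(_ uXY asym) {}IH.
suff edge : \sum_(f : {ffun H -> V}) \prod_(q <- X) G (f q.1, f q.2) *
      \prod_(q <- (i, j) :: Y) F (f q.1, f q.2) -
    \sum_(f : {ffun H -> V}) \prod_(q <- rcons X (i, j)) G (f q.1, f q.2) *
      \prod_(q <- Y) F (f q.1, f q.2) <= eps * #|V|%:R ^+ #|H|.
  by rewrite /= -natr1; lra.
(* [A] takes the factors avoiding [j] and [B] those at [j]. The latter avoid [i], since [(i, j)] is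
   listed once and [(j, i)] never. *)
pose A (f : {ffun H -> V}) :=
  \prod_(q <- X | ~~ touches j q) G (f q.1, f q.2) *
  \prod_(q <- Y | ~~ touches j q) F (f q.1, f q.2).
pose B (f : {ffun H -> V}) :=
  \prod_(q <- X | touches j q) G (f q.1, f q.2) *
  \prod_(q <- Y | touches j q) F (f q.1, f q.2).
have bounds (P Q : pred (H * H)) (f : {ffun H -> V}) :
    0 <= \prod_(q <- X | P q) G (f q.1, f q.2) *
         \prod_(q <- Y | Q q) F (f q.1, f q.2) <= 1.
  have /andP[x0 x1] := prod_bounds X P (fun q => G01 (f q.1, f q.2)).
  have /andP[y0 y1] := prod_bounds Y Q (fun q => F01 (f q.1, f q.2)).
  by rewrite mulr_ge0 // mulr_ile1.
have untouched q : q \in X ++ Y -> touches j q -> ~~ touches i q.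
  case: q => a b abXY tj; apply/negP => ti; move: tj ti abXY ij.
  rewrite /touches => /orP[] /eqP /= -> /orP[] /eqP /= ->; rewrite ?eqxx //.
  - by move=> ji _; have := asym i j; rewrite !mem_cat !inE eqxx orbT => /(_ isT);
      move: ji; rewrite mem_cat => /orP[] ->; rewrite ?orbT.
  - have : uniq (X ++ [:: (i, j)] ++ Y) by [].
    by rewrite (perm_uniq (permEl (perm_catCA _ _ _))) /= => /andP[/negPf->].
have inX q : q \in X -> q \in X ++ Y by rewrite mem_cat => ->.
have inY q : q \in Y -> q \in X ++ Y by rewrite mem_cat orbC => ->.
have split (W : H * H -> R) (Z : seq (H * H)) : \prod_(q <- Z) W q =
    \prod_(q <- Z | ~~ touches j q) W q * \prod_(q <- Z | touches j q) W q.
  by rewrite (bigID (touches j)) mulrC.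
rewrite -sumrB; apply: le_trans (hom_sum_edge (A := A) (B := B) V0 cut ij _ _ _ _).
- apply: ler_sum => f _; rewrite big_cons big_rcons /= /A /B.
  rewrite (split _ X) (split _ Y).
  by rewrite le_eqVlt; apply/orP; left; apply/eqP; ring.
- exact: bounds.
- exact: bounds.
- by move=> f v; rewrite /A !prod_upd.
- by move=> f u; rewrite /B !prod_upd // => q qs; apply: untouched; auto.
Qed.

Lemma hom_sum_cut_close (eps : R) e F G :
  (0 < #|V|)%N -> cut_close eps F G ->
  (forall p, 0 <= F p <= 1) -> (forall p, 0 <= G p <= 1) ->
  (forall i j, e i j -> ~~ e j i) ->
  hom_sum e F <= hom_sum e G + #|H|%:R ^+ 2 * (eps * #|V|%:R ^+ #|H|).
Proof.
move=> V0 cut F01 G01 asym.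
have eps0 : 0 <= eps * #|V|%:R ^+ #|H|.
  rewrite mulr_ge0 ?exprn_ge0 //.
  have n0 : 0 < #|V|%:R ^+ 2 :> R by rewrite exprn_gt0 // ltr0n.
  rewrite -(pmulr_lge0 _ n0).
  (* The cut bound at empty sets already forces [eps] to be nonnegative. *)
  exact: le_trans (normr_ge0 _) (forallP (forallP cut set0) set0).
pose E := [seq p <- index_enum (H * H)%type | e p.1 p.2].
have EE (W : V * V -> R) :
    hom_sum e W = \sum_(f : {ffun H -> V}) \prod_(q <- E) W (f q.1, f q.2).
  by apply: eq_bigr => f _; rewrite big_filter.
have Euniq : uniq E by rewrite filter_uniq // index_enum_uniq.
have := @hom_sum_telescope eps F G [::] E V0 cut Euniq F01 G01.
rewrite !EE /=; under eq_bigr do rewrite big_nil mul1r.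
move=> /(_ _)/le_trans; apply=> [i j|].
  by rewrite !mem_filter /= => /andP[/asym/negPf-> _].
rewrite lerD2l ler_wpM2r // -natrX ler_nat -mulnn -card_prod.
by rewrite -(card_uniqP Euniq) max_card.
Qed.

End Counting.

(** * Blowups in nearly complete tripartite graphs *)

Section PowerMean.
Variable R : realFieldType.

Lemma pow_tangent (a m : R) t : 0 <= a -> 0 <= m ->
  m ^+ t.+1 + t.+1%:R * m ^+ t * (a - m) <= a ^+ t.+1.
Proof.
move=> a0 m0; elim: t => [|t IH]; first by rewrite !expr1 expr0; lra.
(* Multiplying the inductive hypothesis by [a] leaves the surplus [t.+1 * m ^ t * (a - m) ^ 2]. *)
rewrite [leRHS]exprS; apply: le_trans (ler_wpM2l a0 IH).
have : 0 <= t.+1%:R * m ^+ t * (a - m) ^+ 2.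
  by rewrite mulr_ge0 ?sqr_ge0 // mulr_ge0 // exprn_ge0.
by rewrite -[t.+2%:R]natr1 !exprS; lra.
Qed.

(** Jensen: sum the tangent inequality at the mean, where the linear terms cancel. *)
Lemma mean_pow (I : finType) (P : pred I) (F : I -> R) t :
  (forall i, P i -> 0 <= F i) ->
  #|P|%:R * ((\sum_(i | P i) F i) / #|P|%:R) ^+ t <= \sum_(i | P i) F i ^+ t.
Proof.
move=> F0; case: t => [|t].
  by rewrite [leRHS](eq_bigr (fun=> 1)) // expr0 mulr1 sumr_const.
have [P0|P_gt0] := posnP #|P|; first by rewrite P0 mul0r sumr_ge0 // => i /F0; exact: exprn_ge0.
have N0 : 0 < #|P|%:R :> R by rewrite ltr0n.
set m := _ / _; have m0 : 0 <= m by rewrite divr_ge0 // sumr_ge0.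
apply: le_trans (ler_sum _ (fun i Pi => pow_tangent t (F0 i Pi) m0)).
rewrite big_split /= sumr_const -mulr_sumr sumrB sumr_const -![m *+ _]mulr_natl.
by rewrite /m [_ * (_ / _)]mulrC divfK ?gt_eqF // subrr mulr0 addr0 mulr_natl.
Qed.

Lemma markov_card (I : finType) (X : {set I}) (F : I -> R) (u : R) :
  (forall i, i \in X -> 0 <= F i) ->
  #|[set i in X | u < F i]|%:R * u <= \sum_(i in X) F i.
Proof.
move=> F0; rewrite (bigID (fun i => u < F i)) /= -[leLHS]addr0 lerD //.
  have -> : #|[set i in X | u < F i]|%:R * u = \sum_(i in X | u < F i) u.
    by rewrite sumr_const mulr_natl; congr (_ *+ _); apply: eq_card => i; rewrite inE.
  by apply: ler_sum => i /andP[_ /ltW].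
by apply: sumr_ge0 => i /andP[/F0].
Qed.

End PowerMean.

(** * The potential, and growing a blowup vertex by vertex *)

Section NearComplete.
Variables (R : realType) (V : finType) (A : {set V}) (g1 g2 g3 : rel V).
Implicit Types Y Z : {set V}.

Definition nonadj (g : rel V) (Y Z : {set V}) : R :=
  \sum_(y in Y) \sum_(z in Z) (~~ g y z)%:R.

Definition area Y Z : R := #|Y|%:R * #|Z|%:R.

Lemma nonadj_ge0 g Y Z : 0 <= nonadj g Y Z.
Proof. by apply: sumr_ge0 => y _; exact: sumr_ge0. Qed.

Lemma nonadj_sub g Y Y' Z Z' : Y' \subset Y -> Z' \subset Z ->
  nonadj g Y' Z' <= nonadj g Y Z.
Proof.
move=> YY ZZ; rewrite /nonadj [leRHS](big_setID Y') (setIidPr YY) /= -[leLHS]addr0.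
rewrite lerD //; last by apply: sumr_ge0 => y _; exact: sumr_ge0.
apply: ler_sum => y _; rewrite [leRHS](big_setID Z') (setIidPr ZZ) /=.
by rewrite -[leLHS]addr0 lerD // sumr_ge0.
Qed.

Lemma area_gt0 Y Z : Y != set0 -> Z != set0 -> 0 < area Y Z.
Proof. by move=> Y0 Z0; rewrite mulr_gt0 // ltr0n card_gt0. Qed.

(* The nonedge density, plus a price [lam] per unit of logarithmic area lost. *)
Definition psi (lam : R) Y Z : R := nonadj g3 Y Z / area Y Z - lam * ln (area Y Z).

(** Write [N / N'] as [(s * N / N') * s^-1] and use [ln x < x] on both factors; each contributes at
    most [s * N]. *)
Lemma mul_ln_le (s N N' : R) :
  0 < s -> 0 < N' -> 0 < N -> N' <= s ^+ 2 * N -> N' * ln (N / N') <= 2 * s * N.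
Proof.
move=> s0 N'0 N0 le; have x0 : 0 < s * N / N' by rewrite divr_gt0 // mulr_gt0.
have -> : N / N' = (s * N / N') * s^-1 by field; rewrite !gt_eqF.
rewrite lnM ?posrE ?invr_gt0 //.
have /ltW l1 := ln_sublinear x0.
have /ltW l2 : ln s^-1 < s^-1 by rewrite ln_sublinear // invr_gt0.
apply: le_trans (ler_wpM2l (ltW N'0) (lerD l1 l2)) _.
rewrite mulrDr mulrCA divff ?gt_eqF // mulr1.
suff : N' / s <= s * N by lra.
by rewrite ler_pdivrMr // mulrAC -expr2.
Qed.

Section Shrink.
Variables (lam s : R) (Y Z : {set V}).
Hypotheses (lam0 : 0 <= lam) (s0 : 0 < s) (s1 : 2 * s <= 1)
  (Y0 : Y != set0) (Z0 : Z != set0)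
  (opt : forall Y' Z', Y' \subset Y -> Z' \subset Z -> Y' != set0 -> Z' != set0 ->
     psi lam Y Z <= psi lam Y' Z').

(** Optimality bounds the nonedge density of the subrectangle below by that of [Y * Z] minus [lam]
    times the logarithm of the area ratio. Multiplied by its own small area, this loss is controlled
    by [mul_ln_le]. *)
Lemma nonadj_lower Y' Z' : Y' \subset Y -> Z' \subset Z ->
  area Y' Z' <= s ^+ 2 * area Y Z ->
  area Y' Z' * (nonadj g3 Y Z / area Y Z) - 2 * s * lam * area Y Z <= nonadj g3 Y' Z'.
Proof.
move=> YY ZZ le; have N0 := area_gt0 Y0 Z0.
have trivial_case : area Y' Z' = 0 ->
    area Y' Z' * (nonadj g3 Y Z / area Y Z) - 2 * s * lam * area Y Z <= nonadj g3 Y' Z'.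
  move=> ->; apply: le_trans (nonadj_ge0 _ _ _); rewrite mul0r sub0r oppr_le0.
  by rewrite !mulr_ge0 // ltW.
have [Y'0|Y'0] := eqVneq Y' set0.
  by apply: trivial_case; rewrite /area Y'0 cards0 mul0r.
have [Z'0|Z'0] := eqVneq Z' set0.
  by apply: trivial_case; rewrite /area Z'0 cards0 mulr0.
have N'0 := area_gt0 Y'0 Z'0; have := opt YY ZZ Y'0 Z'0; rewrite /psi => le_psi.
have := mul_ln_le s0 N'0 N0 le; rewrite ln_div ?posrE // => le_ln.
have {}le_psi : nonadj g3 Y Z / area Y Z - lam * (ln (area Y Z) - ln (area Y' Z'))
    <= nonadj g3 Y' Z' / area Y' Z' by lra.
have := ler_wpM2l (ltW N'0) le_psi; rewrite mulrCA divff ?gt_eqF // mulr1.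
have := ler_wpM2l lam0 le_ln; lra.
Qed.

(** The two removed strips carry almost their share of nonedges by [nonadj_lower], so the remaining
    nonedge density grows by at most [8 * s * lam]; the logarithm of the area drops by at most
    [4 * s]. *)
Lemma psi_shrink Y1 Z1 : Y1 \subset Y -> Z1 \subset Z ->
  #|Y :\: Y1|%:R <= s ^+ 2 * #|Y|%:R -> #|Z :\: Z1|%:R <= s ^+ 2 * #|Z|%:R ->
  [/\ Y1 != set0, Z1 != set0 & psi lam Y1 Z1 <= psi lam Y Z + 12 * s * lam].
Proof.
move: (lam0) (s0) (s1) => lam_ge0 s_gt0 s_le YY ZZ leY leZ; have N0 := area_gt0 Y0 Z0.
have y0 : 0 < #|Y|%:R :> R by rewrite ltr0n card_gt0.
have z0 : 0 < #|Z|%:R :> R by rewrite ltr0n card_gt0.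
have cY : #|Y|%:R = #|Y1|%:R + #|Y :\: Y1|%:R :> R.
  by rewrite -(cardsID Y1 Y) (setIidPr YY) natrD.
have cZ : #|Z|%:R = #|Z1|%:R + #|Z :\: Z1|%:R :> R.
  by rewrite -(cardsID Z1 Z) (setIidPr ZZ) natrD.
have s2 : 4 * s ^+ 2 <= 1 by have := ler_wpM2l (ltW s0) s1; rewrite expr2; lra.
have y1 : 3 * #|Y|%:R <= 4 * #|Y1|%:R :> R.
  by have := ler_wpM2r (ltW y0) s2; lra.
have z1 : 3 * #|Z|%:R <= 4 * #|Z1|%:R :> R.
  by have := ler_wpM2r (ltW z0) s2; lra.
have Y10 : Y1 != set0 by rewrite -card_gt0 -(ltr0n R); lra.
have Z10 : Z1 != set0 by rewrite -card_gt0 -(ltr0n R); lra.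
split=> //; have N10 := area_gt0 Y10 Z10.
have N1 : area Y Z <= 2 * area Y1 Z1.
  by move: N10; rewrite /area; have := ler_pM _ _ y1 z1; rewrite !mulr_ge0 // => /(_ isT isT); lra.
have areaE : area Y Z = area (Y :\: Y1) Z + area Y1 (Z :\: Z1) + area Y1 Z1.
  by rewrite /area cY cZ; ring.
have badE : nonadj g3 Y Z =
    nonadj g3 (Y :\: Y1) Z + nonadj g3 Y1 (Z :\: Z1) + nonadj g3 Y1 Z1.
  rewrite -addrA {1}/nonadj (big_setID Y1) (setIidPr YY) /= addrC; congr (_ + _).
  rewrite -big_split /=; apply: eq_bigr => y _.
  by rewrite (big_setID Z1) (setIidPr ZZ) /= addrC.
have l1 : area (Y :\: Y1) Z <= s ^+ 2 * area Y Z.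
  by rewrite /area mulrA ler_wpM2r.
have l2 : area Y1 (Z :\: Z1) <= s ^+ 2 * area Y Z.
  by rewrite /area mulrCA ler_pM // ler_nat subset_leq_card.
have dN : area Y Z - area Y1 Z1 <= 2 * s ^+ 2 * area Y Z by lra.
have := nonadj_lower (subsetDl Y Y1) (subxx Z) l1.
have := nonadj_lower YY (subsetDl Z Z1) l2.
set b := _ / _ => b2 b1.
have bE : nonadj g3 Y Z = b * area Y Z by rewrite divfK // gt_eqF.
have up : nonadj g3 Y1 Z1 / area Y1 Z1 <= b + 8 * s * lam.
  rewrite ler_pdivrMr //.
  have slN : s * lam * area Y Z <= s * lam * (2 * area Y1 Z1).
    by rewrite ler_wpM2l // mulr_ge0 // ltW.
  have : b * area Y Z = b * (area (Y :\: Y1) Z + area Y1 (Z :\: Z1) + area Y1 Z1).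
    by rewrite -areaE.
  by lra.
have lnd : ln (area Y Z) - ln (area Y1 Z1) <= 4 * s.
  rewrite -ln_div ?posrE //.
  have -> : area Y Z / area Y1 Z1 = 1 + (area Y Z - area Y1 Z1) / area Y1 Z1.
    by rewrite mulrBl divff ?gt_eqF //; lra.
  have q0 : 0 <= (area Y Z - area Y1 Z1) / area Y1 Z1.
    by rewrite divr_ge0 ?(ltW N10) // areaE addrK addr_ge0 // mulr_ge0.
  apply: le_trans (le_ln1Dx _) _; first lra.
  rewrite ler_pdivrMr //.
  have : 2 * s ^+ 2 <= s by have := ler_wpM2l (ltW s0) s1; rewrite expr2; lra.
  by nra.
have := ler_wpM2l lam0 lnd; rewrite /psi -/b; lra.
Qed.

End Shrink.

Variable t : nat.
Implicit Types p : {ffun 'I_t -> V} * {ffun 'I_t -> V}.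

Definition biclique Y Z p :=
  [&& p.1 \in ffun_on (mem Y), p.2 \in ffun_on (mem Z) &
      [forall i, forall j, g3 (p.1 i) (p.2 j)]].

Definition joined x p := [forall i, g1 x (p.1 i) && g2 x (p.2 i)].

Definition common p := [set x in A | joined x p].

(* The number of homomorphic [K_{s,t,t}] with parts in [A], [Y], [Z]. *)
Definition extensions s Y Z : R := \sum_(p | biclique Y Z p) #|common p|%:R ^+ s.

Definition nbr (g : rel V) x Y := [set y in Y | g x y].

Lemma biclique_nbr x Y Z p :
  biclique (nbr g1 x Y) (nbr g2 x Z) p = biclique Y Z p && joined x p.
Proof.
rewrite /joined; apply/and3P/andP => [[/ffun_onP p1 /ffun_onP p2 g3p]|[]].
  split; last first.
    apply/forallP => i; have := p1 i; have := p2 i.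
    by rewrite !inE => /andP[_ ->] /andP[_ ->].
  by apply/and3P; split=> //; apply/ffun_onP => i;
    [have := p1 i | have := p2 i]; rewrite inE => /andP[].
move=> /and3P[/ffun_onP p1 /ffun_onP p2 g3p] /forallP j; split=> //;
  by apply/ffun_onP => i; case/andP: (j i) => j1 j2; rewrite inE ?(p1 i) ?(p2 i).
Qed.

(** Fix one of the [s.+1] vertices in [A] first; the biclique must then lie in its
    neighbourhoods. *)
Lemma extensionsS s Y Z :
  extensions s.+1 Y Z = \sum_(x in A) extensions s (nbr g1 x Y) (nbr g2 x Z).
Proof.
rewrite (exchange_big_dep (biclique Y Z)) /= => [|x p _]; last first.
  by rewrite biclique_nbr => /andP[].
apply: eq_bigr => p bp; rewrite exprS mulrC mulr_natr -sumr_const.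
by apply: eq_bigl => x; rewrite inE biclique_nbr bp.
Qed.

Lemma extensions_sub s Y Y' Z Z' : Y' \subset Y -> Z' \subset Z ->
  extensions s Y' Z' <= extensions s Y Z.
Proof.
move=> /subsetP YY /subsetP ZZ; rewrite /extensions [leRHS]big_mkcond [leLHS]big_mkcond /=.
apply: ler_sum => p _; case: ifP => [/and3P[/ffun_onP p1 /ffun_onP p2 g3p]|_].
  rewrite ifT //; apply/and3P; split=> //; apply/ffun_onP => i; [exact/YY/p1|exact/ZZ/p2].
by case: ifP => // _; rewrite exprn_ge0.
Qed.

(** Two uses of [mean_pow]: over [z] in [Z] for stars with [t] leaves in [Y], then over [t]-tuples
    of [Y] for their common neighbours. *)
Lemma sidorenko_biclique Y Z : Y != set0 -> Z != set0 ->
  (area Y Z * ((area Y Z - nonadj g3 Y Z) / area Y Z) ^+ t) ^+ t <= extensions 0 Y Z.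
Proof.
move=> Y0 Z0; have y0 : 0 < #|Y|%:R :> R by rewrite ltr0n card_gt0.
have z0 : 0 < #|Z|%:R :> R by rewrite ltr0n card_gt0.
pose d y z : R := (g3 y z)%:R; have d0 y z : 0 <= d y z by [].
(* The number of common neighbours in [Z] of the tuple [y]. *)
pose D (y : {ffun 'I_t -> V}) : R := \sum_(z in Z) \prod_i d (y i) z.
have D0 y : 0 <= D y by apply: sumr_ge0 => z _; exact: prodr_ge0.
have -> : extensions 0 Y Z = \sum_(y in ffun_on (mem Y)) D y ^+ t.
  rewrite /extensions -(pair_big_dep (fun y => y \in ffun_on (mem Y))
    (fun y z => (z \in ffun_on (mem Z)) && [forall i, forall j, g3 (y i) (z j)])
    (fun _ _ => 1 : R)) /=.
  apply: eq_bigr => y _; rewrite -[X in D y ^+ X](card_ord t) -prodr_const.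
  rewrite bigA_distr_big /= big_mkcondr /=; apply: eq_bigr => z _.
  case: ifP => [/forallP h|/negbT].
    by rewrite big1 // => j _; rewrite big1 // => i _; rewrite /d (forallP (h i)).
  rewrite negb_forall => /existsP[i]; rewrite negb_forall => /existsP[j /negPf gij].
  by rewrite (bigD1 j) //= (bigD1 i) //= /d gij !mul0r.
have cardY : #|[pred y : {ffun 'I_t -> V} | y \in ffun_on (mem Y)]|%:R = #|Y|%:R ^+ t :> R.
  rewrite -natrX -[X in (_ ^ X)%N](card_ord t) -card_ffun_on.
  by congr (_%:R); apply: eq_card.
have degE : area Y Z - nonadj g3 Y Z = \sum_(z in Z) \sum_(y in Y) d y z.
    have -> : area Y Z = \sum_(y in Y) \sum_(z in Z) 1.
    under eq_bigr do rewrite sumr_const.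
    by rewrite sumr_const /area -mulrnA mulnC natrM.
  rewrite [RHS]exchange_big -sumrB; apply: eq_bigr => y _.
  by rewrite -sumrB; apply: eq_bigr => z _; rewrite /d; case: g3; rewrite ?subrr ?subr0.
have sumD : #|Z|%:R * ((area Y Z - nonadj g3 Y Z) / #|Z|%:R) ^+ t <=
    \sum_(y in ffun_on (mem Y)) D y.
  have -> : \sum_(y in ffun_on (mem Y)) D y = \sum_(z in Z) (\sum_(y in Y) d y z) ^+ t.
    rewrite exchange_big; apply: eq_bigr => z _.
    by rewrite -[X in _ ^+ X](card_ord t) -prodr_const bigA_distr_big.
  by rewrite degE; apply: mean_pow => z _; exact: sumr_ge0.
apply: le_trans (mean_pow t (fun y _ => D0 y)); rewrite cardY.
have yt0 : 0 < #|Y|%:R ^+ t :> R by rewrite exprn_gt0.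
have b0 : 0 <= area Y Z - nonadj g3 Y Z.
  by rewrite degE; apply: sumr_ge0 => z _; exact: sumr_ge0.
rewrite /area in b0 sumD *; move: b0 sumD; set e := _ - _ => b0 sumD.
have -> : (#|Y|%:R * #|Z|%:R * (e / (#|Y|%:R * #|Z|%:R)) ^+ t) ^+ t =
  #|Y|%:R ^+ t * ((#|Z|%:R * (e / #|Z|%:R) ^+ t) / #|Y|%:R ^+ t) ^+ t.
  rewrite -[#|Y|%:R * #|Z|%:R * _]mulrA exprMn; congr (_ * _); congr (_ ^+ _).
  by rewrite !expr_div_n exprMn; field; rewrite !gt_eqF ?exprn_gt0.
rewrite ler_pM2l // lerXn2r // ?nnegrE ?divr_ge0 ?(ltW yt0) //.
- by rewrite mulr_ge0 // exprn_ge0 // divr_ge0.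
- exact: sumr_ge0.
- by rewrite ler_pM2r // invr_gt0.
Qed.


Lemma card_setD_nbr g x Y :
  #|Y :\: nbr g x Y|%:R = \sum_(y in Y) (~~ g x y)%:R :> R.
Proof.
rewrite -sum1_card natr_sum [RHS]big_mkcond [LHS]big_mkcond /=.
by apply: eq_bigr => y _; rewrite !inE; case: (y \in Y); case: (g x y).
Qed.

(** On average [x] misses at most [tau ^ 2 * #|Y|] vertices of [Y]; by Markov at most a quarter of
    [A] misses four times as many. *)
Lemma few_shrink_a_lot g (tau : R) Y : 0 < tau -> Y != set0 ->
  (forall y, y \in Y -> \sum_(x in A) (~~ g x y)%:R <= tau ^+ 2 * #|A|%:R) ->
  #|[set x in A | (2 * tau) ^+ 2 * #|Y|%:R < #|Y :\: nbr g x Y|%:R]|%:R * 4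
    <= #|A|%:R :> R.
Proof.
move=> tau0 Y0 deg; have y0 : 0 < #|Y|%:R :> R by rewrite ltr0n card_gt0.
set X := [set x in A | _].
have := @markov_card R _ A (fun x => #|Y :\: nbr g x Y|%:R) ((2 * tau) ^+ 2 * #|Y|%:R)
  (fun _ _ => ler0n _ _).
rewrite -/X; under [leRHS]eq_bigr do rewrite card_setD_nbr.
rewrite exchange_big /= => /le_trans/(_ (ler_sum _ deg)).
rewrite sumr_const -[leRHS]mulr_natl exprMn => le.
have u0 : 0 < tau ^+ 2 * #|Y|%:R by rewrite mulr_gt0 // exprn_gt0.
by rewrite -(ler_pM2r u0); lra.
Qed.

Definition mild (tau : R) Y Z x :=
  (#|Y :\: nbr g1 x Y|%:R <= (2 * tau) ^+ 2 * #|Y|%:R) &&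
  (#|Z :\: nbr g2 x Z|%:R <= (2 * tau) ^+ 2 * #|Z|%:R).

Lemma many_mild (tau : R) Y Z : 0 < tau -> Y != set0 -> Z != set0 ->
  (forall y, y \in Y -> \sum_(x in A) (~~ g1 x y)%:R <= tau ^+ 2 * #|A|%:R) ->
  (forall z, z \in Z -> \sum_(x in A) (~~ g2 x z)%:R <= tau ^+ 2 * #|A|%:R) ->
  #|A|%:R <= 2 * #|[set x in A | mild tau Y Z x]|%:R :> R.
Proof.
move=> tau0 Y0 Z0 deg1 deg2.
have := few_shrink_a_lot tau0 Y0 deg1; have := few_shrink_a_lot tau0 Z0 deg2.
set X2 := [set x in A | _]; set X1 := [set x in A | _] => le2 le1.
set X := [set x in A | _].
suff : (#|A| <= #|X| + #|X1| + #|X2|)%N.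
  by rewrite -(ler_nat R) !natrD; lra.
apply: leq_trans (leq_trans (leq_card_setU _ X2) (leq_add (leq_card_setU X X1) (leqnn _))).
apply/subset_leq_card/subsetP => x xA; rewrite !inE xA /= /mild !ltNge.
by case: (_ <= _); case: (_ <= _).
Qed.

(* Each new vertex [x] restricts an optimal subrectangle of [Y * Z] to the
   neighbours of [x], which raises [psi] by at most [24 * tau * lam]. *)
Lemma extensions_lower (tau lam psi0 K : R) (B C : {set V}) s Y Z :
  0 < tau -> 4 * tau <= 1 -> 0 <= lam -> 0 <= K ->
  (forall y, y \in B -> \sum_(x in A) (~~ g1 x y)%:R <= tau ^+ 2 * #|A|%:R) ->
  (forall z, z \in C -> \sum_(x in A) (~~ g2 x z)%:R <= tau ^+ 2 * #|A|%:R) ->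
  (forall Y Z, Y \subset B -> Z \subset C -> Y != set0 -> Z != set0 ->
    psi lam Y Z <= psi0 -> K <= extensions 0 Y Z) ->
  Y \subset B -> Z \subset C -> Y != set0 -> Z != set0 ->
  psi lam Y Z <= psi0 - s%:R * (24 * tau * lam) ->
  (#|A|%:R / 2) ^+ s * K <= extensions s Y Z.
Proof.
move=> tau0 tau1 lam0 K0 deg1 deg2 base; elim: s Y Z => [|s IH] Y Z YB ZC Y0 Z0.
  by rewrite mul0r subr0 expr0 mul1r; exact: base.
rewrite -natr1 => psiYZ.
pose P (q : {set V} * {set V}) :=
  [&& q.1 \subset Y, q.2 \subset Z, q.1 != set0 & q.2 != set0].
have PYZ : P (Y, Z) by rewrite /P !subxx Y0 Z0.
(* Pass to a minimizing subrectangle; [extensions] can only decrease. *)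
case: (arg_minP (fun q : {set V} * {set V} => psi lam q.1 q.2) PYZ).
move=> [Y' Z'] /and4P[/= Y'Y Z'Z Y'0 Z'0] opt.
have opt' Y1 Z1 : Y1 \subset Y' -> Z1 \subset Z' -> Y1 != set0 -> Z1 != set0 ->
    psi lam Y' Z' <= psi lam Y1 Z1.
  move=> s1 s2 Y10 Z10; apply: (opt (Y1, Z1)).
  by rewrite /P /= Y10 Z10 (subset_trans s1) // (subset_trans s2).
have Y'B := subset_trans Y'Y YB; have Z'C := subset_trans Z'Z ZC.
apply: le_trans (extensions_sub s.+1 Y'Y Z'Z); rewrite extensionsS.
set M := [set x in A | mild tau Y' Z' x].
have cardM : #|A|%:R <= 2 * #|M|%:R :> R.
  apply: many_mild => // [y /(subsetP Y'B)|z /(subsetP Z'C)]; [exact: deg1|exact: deg2].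
have MA : M \subset A by apply/subsetP => x; rewrite inE => /andP[].
rewrite (big_setID M) (setIidPr MA) /= -[leLHS]addr0 lerD //; last first.
  by apply: sumr_ge0 => x _; apply: sumr_ge0 => p _; rewrite exprn_ge0.
have step x : x \in M -> (#|A|%:R / 2) ^+ s * K <=
    extensions s (nbr g1 x Y') (nbr g2 x Z').
  rewrite inE => /andP[xA /andP[m1 m2]].
  have n1 : nbr g1 x Y' \subset Y' by apply/subsetP => y; rewrite inE => /andP[].
  have n2 : nbr g2 x Z' \subset Z' by apply/subsetP => z; rewrite inE => /andP[].
  have tau2 : 0 < 2 * tau by lra.
  have tau3 : 2 * (2 * tau) <= 1 by lra.
  (* With [2 * tau] for [s], the increase [12 * s * lam] is the [24 * tau * lam] budgeted per
     vertex. *)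
  have [ne1 ne2 le] := psi_shrink lam0 tau2 tau3 Y'0 Z'0 opt' n1 n2 m1 m2.
  apply: IH => //; [exact: subset_trans n1 _|exact: subset_trans n2 _|].
  by have := opt _ PYZ; rewrite /=; lra.
apply: le_trans (ler_sum _ step); rewrite sumr_const -[leRHS]mulr_natl exprSr -mulrA.
rewrite mulrCA ler_wpM2r ?mulr_ge0 ?exprn_ge0 ?divr_ge0 //.
by rewrite ler_pdivrMr //; lra.
Qed.

(** Markov's inequality, splitting [tau ^ 4] into [tau ^ 2] for the proportion of discarded vertices
    and [tau ^ 2] for the remaining nondegrees. *)
Lemma discard_high_degree (g : rel V) (tau : R) B : 0 < tau -> A != set0 ->
  nonadj g A B <= tau ^+ 4 * area A B ->
  exists B' : {set V}, [/\ B' \subset B, (1 - tau ^+ 2) * #|B|%:R <= #|B'|%:R &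
    forall y, y \in B' -> \sum_(x in A) (~~ g x y)%:R <= tau ^+ 2 * #|A|%:R].
Proof.
move=> tau0 A0 le; have a0 : 0 < #|A|%:R :> R by rewrite ltr0n card_gt0.
pose deg y : R := \sum_(x in A) (~~ g x y)%:R.
have B'B : [set y in B | deg y <= tau ^+ 2 * #|A|%:R] \subset B.
  by apply/subsetP => y; rewrite inE => /andP[].
exists [set y in B | deg y <= tau ^+ 2 * #|A|%:R]; split=> //; last first.
  by move=> y; rewrite inE => /andP[].
have := @markov_card R _ B deg (tau ^+ 2 * #|A|%:R)
  (fun y _ => sumr_ge0 _ (fun x _ => ler0n _ _)).
rewrite exchange_big /= => /le_trans/(_ le).
pose N : R := #|[set y in B | tau ^+ 2 * #|A|%:R < deg y]|%:R.
rewrite /area -/N => leN.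
have u0 : 0 < tau ^+ 2 * #|A|%:R by rewrite mulr_gt0 // exprn_gt0.
have {leN}N1 : N <= tau ^+ 2 * #|B|%:R.
  rewrite -(ler_pM2r u0); apply: le_trans leN _.
  by rewrite le_eqVlt; apply/orP; left; apply/eqP; ring.
suff : #|B|%:R = #|[set y in B | deg y <= tau ^+ 2 * #|A|%:R]|%:R + N by lra.
rewrite -(cardsID [set y in B | deg y <= tau ^+ 2 * #|A|%:R] B) (setIidPr B'B).
rewrite natrD; congr (_ + _%:R); apply: eq_card => y; rewrite !inE ltNge.
by case: (y \in B); case: (_ <= _).
Qed.

Lemma near_complete (tau : R) (B C : {set V}) :
  0 < tau -> 56 * tau <= 1 -> A != set0 -> B != set0 -> C != set0 -> (0 < t)%N ->
  nonadj g1 A B <= tau ^+ 4 * area A B ->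
  nonadj g2 A C <= tau ^+ 4 * area A C ->
  nonadj g3 B C <= tau ^+ 4 * area B C ->
  (#|A|%:R * area B C / 8) ^+ t * (1 - 56 * tau) ^+ (t ^ 2) <= extensions t B C.
Proof.
move=> tau0 tau1 A0 B0 C0 t0 bad1 bad2 bad3.
have [B' [B'B cB degB]] := discard_high_degree tau0 A0 bad1.
have [C' [C'C cC degC]] := discard_high_degree tau0 A0 bad2.
have b0 : 0 < #|B|%:R :> R by rewrite ltr0n card_gt0.
have c0 : 0 < #|C|%:R :> R by rewrite ltr0n card_gt0.
have a0 : 0 < #|A|%:R :> R by rewrite ltr0n card_gt0.
have tau2 : 2 * tau ^+ 2 <= 1 by rewrite expr2; nra.
have b'0 : #|B|%:R <= 2 * #|B'|%:R :> R by have := ler_wpM2r (ltW b0) tau2; lra.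
have c'0 : #|C|%:R <= 2 * #|C'|%:R :> R by have := ler_wpM2r (ltW c0) tau2; lra.
have B'0 : B' != set0 by rewrite -card_gt0 -(ltr0n R); lra.
have C'0 : C' != set0 by rewrite -card_gt0 -(ltr0n R); lra.
have N0 := area_gt0 B'0 C'0; set N' := area B' C' in N0.
have leN : area B C <= 4 * N'.
  by have := ler_pM _ _ b'0 c'0; rewrite !ler0n => /(_ isT isT); rewrite /N' /area; lra.
(* Bounds the nonedge density of [B' * C'], whose area is at least a quarter of that of [B * C]. *)
pose eta := 4 * tau ^+ 4; have eta0 : 0 < eta by rewrite mulr_gt0 // exprn_gt0.
have eta1 : 2 * eta <= 8 * tau.
  have tau_le1 : tau <= 1 by lra.
  by rewrite /eta exprSr; have := ler_wpM2r (ltW tau0) (exprn_ile1 3 (ltW tau0) tau_le1); lra.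
have bad3' : nonadj g3 B' C' <= eta * N'.
  apply: le_trans (nonadj_sub _ B'B C'C) (le_trans bad3 _).
  by rewrite /eta; have := ler_wpM2l (exprn_ge0 4 (ltW tau0)) leN; lra.
have tn0 : 0 < t%:R :> R by rewrite ltr0n.
(* Chosen so that [t] vertices raise [psi] by [eta] in total. *)
pose lam := eta / (24 * tau * t%:R).
have lam0 : 0 < lam by rewrite divr_gt0 // !mulr_gt0.
have lamE : t%:R * (24 * tau * lam) = eta by rewrite /lam; field; rewrite !gt_eqF.
pose q := 1 - 56 * tau; have q0 : 0 <= q by rewrite /q; lra.
(* A final rectangle with [psi] this small has nonedge density at most [2 * eta <= 8 * tau] and has
   lost at most a factor [exp (48 * tau * t)] of area; the two losses add up to [56 * tau] in
   [q]. *)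
have base Y Z : Y \subset B' -> Z \subset C' -> Y != set0 -> Z != set0 ->
    psi lam Y Z <= 2 * eta - lam * ln N' -> N' ^+ t * q ^+ (t ^ 2) <= extensions 0 Y Z.
  move=> YB ZC Y0 Z0; have N1 := area_gt0 Y0 Z0; rewrite /psi.
  set N := area Y Z in N1 *; set b := nonadj g3 Y Z / N => le_psi.
  have b_ge0 : 0 <= b by rewrite divr_ge0 ?nonadj_ge0 // ltW.
  have NN' : N <= N' by rewrite ler_pM // ler_nat subset_leq_card.
  have lnNN' : ln N <= ln N' by rewrite ler_ln.
  have b_le : b <= 8 * tau by have := ler_wpM2l (ltW lam0) lnNN'; lra.
  have ln_le : ln N' - ln N <= 48 * tau * t%:R.
    have : lam * (ln N' - ln N) <= 2 * eta by lra.
    by rewrite -lamE => h; rewrite -(ler_pM2l lam0); lra.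
  have N_ge : N' * sequences.expR (- (48 * tau)) ^+ t <= N.
    rewrite -expRM_natl -[X in X * _](lnK (_ : N' \in Num.pos)) ?posrE //.
    by rewrite -expRD -[leRHS](lnK (_ : N \in Num.pos)) ?posrE // ler_expR; lra.
  apply: le_trans (sidorenko_biclique Y0 Z0).
  have -> : (area Y Z - nonadj g3 Y Z) / area Y Z = 1 - b.
    by rewrite mulrBl divff ?gt_eqF.
  rewrite -mulnn exprM -exprMn lerXn2r ?nnegrE //.
  - by rewrite mulr_ge0 // ?exprn_ge0 // ltW.
  - by apply: mulr_ge0; [exact: ltW | apply: exprn_ge0; lra].
  have qle : q <= sequences.expR (- (48 * tau)) * (1 - b).
    have := expR_ge1Dx (- (48 * tau)); rewrite /q => le1.
    have : 0 <= 1 - b by lra.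
    by move=> /(fun h => ler_wpM2r h le1); nra.
  have pow_le : q ^+ t <= (sequences.expR (- (48 * tau)) * (1 - b)) ^+ t.
    by rewrite lerXn2r ?nnegrE // mulr_ge0 ?expR_ge0 //; lra.
  apply: le_trans (ler_wpM2l (ltW N0) pow_le) _.
  by rewrite exprMn mulrA ler_wpM2r // exprn_ge0; lra.
have K0 : 0 <= N' ^+ t * q ^+ (t ^ 2) by rewrite mulr_ge0 // exprn_ge0 // ltW.
have tau4 : 4 * tau <= 1 by lra.
have := extensions_lower (s := t) tau0 tau4 (ltW lam0) K0 degB degC base (subxx _)
  (subxx _) B'0 C'0.
rewrite lamE /psi -/N' => /(_ _) main.
apply: le_trans (extensions_sub t B'B C'C); apply: le_trans (main _); last first.
  by have : nonadj g3 B' C' / N' <= eta by [rewrite ler_pdivrMr]; lra.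
rewrite [leRHS]mulrA -exprMn ler_wpM2r ?exprn_ge0 // lerXn2r ?nnegrE ?divr_ge0 //.
- by rewrite !mulr_ge0 // ltW.
- by rewrite mulr_ge0 // ?divr_ge0 // ltW.
- have := ler_wpM2l (ltW a0) leN; lra.
Qed.

End NearComplete.

(** * Choice of the blocks *)

Section Selection.
Variables (R : realType) (V H : finType).
Implicit Types (W F G : V * V -> R) (e : rel H).

Lemma cut_closeC (eps : R) F G : cut_close eps F G = cut_close eps G F.
Proof.
apply: eq_forallb => S; apply: eq_forallb => T; rewrite -normrN -sumrN.
congr (`|_| <= _); apply: eq_bigr => x _; rewrite -sumrN.
by apply: eq_bigr => y _; rewrite opprB.
Qed.

Lemma sum_coord (i : H) (Q : V -> R) : (0 < #|V|)%N ->
  \sum_(f : {ffun H -> V}) Q (f i) = #|V|%:R ^+ #|H| * ((\sum_v Q v) / #|V|%:R).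
Proof.
move=> V0; have n0 : #|V|%:R != 0 :> R by rewrite pnatr_eq0 -lt0n.
apply: (mulfI n0); rewrite -(sum_upd (fun f : {ffun H -> V} => Q (f i)) i).
under eq_bigr do under eq_bigr do rewrite ffunE eqxx.
by rewrite sumr_const card_ffun -[LHS]mulr_natl natrX; field.
Qed.

Lemma sum_coord2 (i j : H) (Q : V * V -> R) : (0 < #|V|)%N -> i != j ->
  \sum_(f : {ffun H -> V}) Q (f i, f j) =
  #|V|%:R ^+ #|H| * ((\sum_p Q p) / #|V|%:R ^+ 2).
Proof.
move=> V0 ij; have n0 : #|V|%:R != 0 :> R by rewrite pnatr_eq0 -lt0n.
apply: (mulfI n0); rewrite -(sum_upd (fun f : {ffun H -> V} => Q (f i, f j)) j).
under eq_bigr do under eq_bigr do rewrite !ffunE eqxx (negPf ij).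
rewrite (sum_coord i (fun x => \sum_u Q (x, u))) // pair_big /=.
rewrite (eq_bigr Q) => [|[]//]; by field.
Qed.

(** All factors lie in [[0, 1]], so exchanging one of them moves the product by at most its own
    change. *)
Lemma prod_perturb (I : Type) (s : seq I) (P : pred I) (a b : I -> R) :
  (forall i, 0 <= a i <= 1) -> (forall i, 0 <= b i <= 1) ->
  \prod_(i <- s | P i) b i - \sum_(i <- s | P i) `|b i - a i|
    <= \prod_(i <- s | P i) a i.
Proof.
move=> a01 b01; elim: s => [|i s IH]; first by rewrite !big_nil subr0.
rewrite !big_cons; case: (P i) => //.
have /andP[x0 x1] := prod_bounds s P a01; have /andP[y0 y1] := prod_bounds s P b01.
have /andP[ai0 ai1] := a01 i; have /andP[bi0 bi1] := b01 i.
set x := \prod_(_ <- _ | _) a _ in IH x0 x1 *; set y := \prod_(_ <- _ | _) b _ in IH y0 y1 *.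
set S := \sum_(_ <- _ | _) _ in IH *.
have S0 : 0 <= S by apply: sumr_ge0.
have h1 : (b i - a i) * y <= `|b i - a i|.
  apply: le_trans (ler_wpM2r y0 (ler_norm _)) _.
  by rewrite -[leRHS]mulr1 ler_wpM2l.
have h2 : a i * (y - x) <= S.
  have := ler_wpM2l ai0 (_ : y - x <= S) => /(_ ltac:(lra)) /le_trans; apply.
  by rewrite -[leRHS]mul1r ler_wpM2r.
lra.
Qed.

(** Converts an [L^2] bound into an [L^1] bound, with [s] as the balance. *)
Lemma norm_le_sqr (s x : R) : 0 < s -> `|x| <= s + x ^+ 2 / s.
Proof.
move=> s0; rewrite -(ler_pM2r s0) mulrDl divfK ?gt_eqF //.
rewrite -[x ^+ 2]real_normK ?num_real // -subr_ge0.
have -> : s * s + `|x| ^+ 2 - `|x| * s = (`|x| - s / 2) ^+ 2 + 3 / 4 * s ^+ 2 by field.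
by rewrite addr_ge0 ?sqr_ge0 // mulr_ge0 ?sqr_ge0 //; lra.
Qed.

Lemma exists_above_mean (I : finType) (Q : I -> R) (x : R) :
  #|I|%:R * x < \sum_i Q i -> exists i, x < Q i.
Proof.
move=> lt; apply/existsP; apply: contraTT lt => /existsPn le.
rewrite -leNgt mulr_natl -sumr_const; apply: ler_sum => i _.
by rewrite leNgt.
Qed.

(** There are at most [m] blocks, and each one that counts has fewer than [v] elements. *)
Lemma few_in_small_blocks (c : V -> nat) m (v : R) : 0 <= v ->
  (forall x, (c x < m)%N) ->
  \sum_x ((#|[pred u | c u == c x]|%:R < v)%R : nat)%:R <= m%:R * v.
Proof.
move=> v0 cm; pose k x := Ordinal (cm x).
rewrite (partition_big k xpredT) //= -[X in X%:R * _](card_ord m) mulr_natl -sumr_const.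
apply: ler_sum => i _.
have [small|big] := ltP (#|[pred u | c u == i]|%:R) v; last first.
  rewrite big1 // => x /eqP kx; have -> : c x = i by rewrite -kx.
  by rewrite ltNge big.
apply: le_trans (ltW small); rewrite -sum1_card natr_sum.
rewrite [leRHS](eq_bigl (fun x => k x == i)) => [|x]; last by rewrite inE.
by apply: ler_sum => x _; case: (_ < _).
Qed.

(* Averaging over all maps [f : H -> V], with penalties for edges on which the
   fine density is far from the coarse one and for vertices in small blocks. *)
Lemma select_blocks e (c c' : V -> nat) m w (eps zeta s L v rho : R) :
  (0 < #|V|)%N -> (forall i j, e i j -> ~~ e j i) ->
  (forall p, 0 <= w p <= 1) -> (forall x, (c x < m)%N) ->
  (forall x y, c' x = c' y -> c x = c y) ->
  0 < s -> 0 < L -> 0 <= v -> 0 <= rho -> 0 <= zeta -> 0 <= eps ->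
  cut_close eps w (cond_exp (box c') w) ->
  energy (box c') w <= energy (box c) w + zeta * #|V|%:R ^+ 2 ->
  rho + #|H|%:R ^+ 2 * (eps + s + zeta * (s^-1 + L)) + #|H|%:R * (m%:R * v)
    < hom_sum e w / #|V|%:R ^+ #|H| ->
  exists f : {ffun H -> V}, [/\
    forall i, v * #|V|%:R <= #|[pred u | c u == c (f i)]|%:R,
    forall i j, e i j -> L * cond_exp (box c)
      (fun p => (cond_exp (box c') w p - cond_exp (box c) w p) ^+ 2) (f i, f j) <= 1 &
    rho <= \prod_(p : H * H | e p.1 p.2) cond_exp (box c) w (f p.1, f p.2)].
Proof.
move=> V0 asym w01 cm ref s0 L0 v0 rho0 zeta0 eps0 cut en.
set W' := cond_exp (box c') w; set W := cond_exp (box c) w in cut en *.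
have n0 : 0 < #|V|%:R :> R by rewrite ltr0n.
have nH0 : 0 < #|V|%:R ^+ #|H| :> R by rewrite exprn_gt0.
have W'01 p : 0 <= W' p <= 1 by exact: cond_exp_bounds.
have W01 p : 0 <= W p <= 1 by exact: cond_exp_bounds.
pose d p := (W' p - W p) ^+ 2; pose D := cond_exp (box c) d.
have d0 p : 0 <= d p by exact: sqr_ge0.
have D0 p : 0 <= D p by rewrite divr_ge0 // sumr_ge0.
pose small x : R := ((#|[pred u | c u == c x]|%:R < v * #|V|%:R)%R : nat)%:R.
have sumd : \sum_p d p <= zeta * #|V|%:R ^+ 2.
  by rewrite energy_refine => [|p q [/ref h1 /ref h2]]; [lra | rewrite /box h1 h2].
have sumD : \sum_p D p <= zeta * #|V|%:R ^+ 2 by rewrite sum_cond_exp.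
have ne i j : e i j -> i != j.
  by apply: contraTneq => ->; apply/negP => ejj; move: (asym _ _ ejj); rewrite ejj.
pose Q (f : {ffun H -> V}) := \prod_(p : H * H | e p.1 p.2) W (f p.1, f p.2)
  - L * (\sum_(p : H * H | e p.1 p.2) D (f p.1, f p.2)) - \sum_i small (f i).
have cardE : #|[pred p : H * H | e p.1 p.2]|%:R <= #|H|%:R ^+ 2 :> R.
  by rewrite -natrX ler_nat -mulnn -card_prod max_card.
have sum_edges (q : V * V -> R) : (forall p, 0 <= q p) ->
    \sum_p q p <= zeta * #|V|%:R ^+ 2 ->
    \sum_(f : {ffun H -> V}) \sum_(p : H * H | e p.1 p.2) q (f p.1, f p.2) <=
    #|V|%:R ^+ #|H| * (#|H|%:R ^+ 2 * zeta).
  move=> q0 sumq; rewrite exchange_big /=.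
  apply: (@le_trans _ _ (\sum_(p : H * H | e p.1 p.2) #|V|%:R ^+ #|H| * zeta)).
    apply: ler_sum => -[i j] /= /ne ij; rewrite sum_coord2 // ler_wpM2l ?(ltW nH0) //.
    by rewrite ler_pdivrMr ?exprn_gt0.
  rewrite sumr_const -[leLHS]mulr_natl mulrCA ler_wpM2l ?(ltW nH0) //.
  by rewrite ler_wpM2r.
move=> lt.
have [|f] := @exists_above_mean _ Q rho.
  rewrite card_ffun natrX.
  have h1 := hom_sum_cut_close V0 cut w01 W'01 asym.
  have h2 := sum_edges d d0 sumd; have h3 := sum_edges D D0 sumD.
  have h4 : \sum_(f : {ffun H -> V}) \sum_i small (f i) <=
      #|V|%:R ^+ #|H| * (#|H|%:R * (m%:R * v)).
    rewrite exchange_big /=.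
    apply: (@le_trans _ _ (\sum_(i : H) #|V|%:R ^+ #|H| * (m%:R * v))); last first.
      by rewrite sumr_const -[leLHS]mulr_natl mulrCA.
    apply: ler_sum => i _; rewrite sum_coord // ler_wpM2l ?(ltW nH0) //.
    rewrite ler_pdivrMr // -mulrA; apply: few_in_small_blocks => //.
    by rewrite mulr_ge0.
  (* Replace fine densities by coarse ones edge by edge, the error being controlled in [L^2] by the
     energy gap. *)
  have h5 : hom_sum e W' - #|V|%:R ^+ #|H| * (#|H|%:R ^+ 2 * (s + zeta / s)) <=
      \sum_(f : {ffun H -> V}) \prod_(p : H * H | e p.1 p.2) W (f p.1, f p.2).
    apply: (@le_trans _ _ (\sum_(f : {ffun H -> V})
        (\prod_(p : H * H | e p.1 p.2) W' (f p.1, f p.2) -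
         (\sum_(p : H * H | e p.1 p.2) s +
          (\sum_(p : H * H | e p.1 p.2) d (f p.1, f p.2)) / s)))); last first.
      apply: ler_sum => f _; apply: le_trans (prod_perturb _ _
        (fun p => W01 (f p.1, f p.2)) (fun p => W'01 (f p.1, f p.2))).
      rewrite lerD2l lerN2 mulr_suml -big_split; apply: ler_sum => p _.
      exact: norm_le_sqr.
    rewrite sumrB big_split /= -mulr_suml /hom_sum.
    have h6 : \sum_(f : {ffun H -> V}) \sum_(p : H * H | e p.1 p.2) s <=
        #|V|%:R ^+ #|H| * (#|H|%:R ^+ 2 * s).
      rewrite sumr_const card_ffun -[leLHS]mulr_natl natrX ler_wpM2l ?(ltW nH0) //.
      by rewrite sumr_const -[leLHS]mulr_natl ler_wpM2r // ltW.
    have si0 : 0 < s^-1 by rewrite invr_gt0.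
    rewrite lerD2l lerN2 !mulrDr mulrA; apply: le_trans (lerD h6 (ler_wpM2r (ltW si0) h2)) _.
    by rewrite !mulrA.
  rewrite /Q !sumrB -mulr_sumr.
  move: lt; rewrite ltr_pdivlMr // => lt.
  move: lt h1 (ler_wpM2l (ltW L0) h3) h4 h5.
  move: (hom_sum e w) (hom_sum e W') (\sum_(f : {ffun H -> V}) \prod_(_ | _) _) => A B S1.
  move: (\sum_(f : {ffun H -> V}) \sum_(_ | _) _) (\sum_(f : {ffun H -> V}) \sum_i _) => S2 S3.
  move: (#|V|%:R ^+ #|H|) (#|H|%:R ^+ 2) (#|H|%:R * _) (s^-1) => N k2 K si.
  by clear; lra.
rewrite /Q => ltQ; exists f.
set P := \prod_(_ | _) _ in ltQ *.
(* The score exceeds [rho >= 0] while [P <= 1], so the total penalty is below 1; a single vertex in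
   a small block would already cost 1. *)
have P1 : P <= 1.
  by have /andP[] := prod_bounds (index_enum (H * H)%type) (fun p => e p.1 p.2)
    (fun p => W01 (f p.1, f p.2)).
have S0 : 0 <= \sum_i small (f i) by exact: sumr_ge0.
have E0 : 0 <= L * \sum_(p : H * H | e p.1 p.2) D (f p.1, f p.2).
  by rewrite mulr_ge0 ?(ltW L0) // sumr_ge0.
split=> [i|i j eij|]; last by lra.
- rewrite leNgt; apply/negP => sm.
  have : 1 <= \sum_i small (f i).
    by rewrite (bigD1 i) //= /small sm lerDl sumr_ge0.
  lra.
- have : D (f i, f j) <= \sum_(p : H * H | e p.1 p.2) D (f p.1, f p.2).
    by rewrite (bigD1 (i, j)) //= lerDl sumr_ge0.
  move=> /(ler_wpM2l (ltW L0)); rewrite /D /d; lra.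
Qed.

End Selection.

(** * From blocks to blowups *)

Section Blowup.
Variables (R : realType) (V : finType).

Lemma cond_exp_box (c : V -> nat) (d : V * V -> R) x y :
  cond_exp (box c) d (x, y) *
    area R [set u | c u == c x] [set u | c u == c y] =
  \sum_(u in [set u | c u == c x]) \sum_(v in [set u | c u == c y]) d (u, v).
Proof.
have cardE : area R [set u | c u == c x] [set u | c u == c y] =
    #|[pred q | box c q == box c (x, y)]|%:R.
  rewrite /area -natrM -cardsX; congr (_%:R); apply: eq_card => -[u v].
  by rewrite !inE /box xpair_eqE.
rewrite cardE /cond_exp divfK ?gt_eqF ?card_fiber_gt0 // pair_big /=.
apply: eq_big => [[u v]|[u v] _ //]; by rewrite !inE /box xpair_eqE.
Qed.

(** Chebyshev: each low pair deviates from the block density by at least [k * rho]. *)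
Lemma few_low_pairs (c : V -> nat) (W W' : V * V -> R) x y (k rho tau : R) :
  (forall p q, box c p = box c q -> W p = W q) ->
  0 < k -> 0 < rho -> rho <= W (x, y) ->
  cond_exp (box c) (fun p => (W' p - W p) ^+ 2) (x, y) <= tau ^+ 4 * (k * rho) ^+ 2 ->
  nonadj R (fun u v => (1 - k) * W (x, y) <= W' (u, v))
    [set u | c u == c x] [set u | c u == c y]
  <= tau ^+ 4 * area R [set u | c u == c x] [set u | c u == c y].
Proof.
move=> Wc k0 rho0 rhoW D_le.
set A := [set u | c u == c x]; set B := [set u | c u == c y].
have area0 : 0 <= area R A B by rewrite mulr_ge0.
have kr0 : 0 < (k * rho) ^+ 2 by rewrite exprn_gt0 // mulr_gt0.
rewrite -(ler_pM2r kr0).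
apply: (@le_trans _ _ (cond_exp (box c) (fun p => (W' p - W p) ^+ 2) (x, y) * area R A B)).
  rewrite cond_exp_box mulr_suml; apply: ler_sum => u; rewrite inE => /eqP cu.
  rewrite mulr_suml; apply: ler_sum => v; rewrite inE => /eqP cv.
  have -> : W (u, v) = W (x, y) by apply: Wc; rewrite /box cu cv.
  case: (lerP ((1 - k) * W (x, y)) (W' (u, v))) => [_|lt].
    by rewrite mul0r sqr_ge0.
  have kr : 0 <= k * rho by rewrite ltW // mulr_gt0.
  have dev : k * rho <= - (W' (u, v) - W (x, y)).
    by have := ler_wpM2l (ltW k0) rhoW; lra.
  by rewrite mul1r -[leRHS]sqrrN !expr2 ler_pM.
by have := ler_wpM2r area0 D_le; lra.
Qed.

Lemma hom_count_sum (H G : sgraph) (e : rel H) :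
  (forall x y : H, edge x y = e x y || e y x) ->
  (hom_count H G)%:R = hom_sum e (fun p : G * G => (edge p.1 p.2)%:R : R).
Proof.
move=> edgeE; rewrite /hom_count -sum1_card natr_sum [LHS]big_mkcond.
apply: eq_bigr => f _; rewrite inE /=; case: ifPn => [/forallP hom|].
  rewrite big1 // => -[x y] /= exy; have /forallP/(_ y)/implyP := hom x.
  by rewrite edgeE exy => ->.
rewrite negb_forall => /existsP[x]; rewrite negb_forall => /existsP[y].
rewrite negb_imply edgeE => /andP[/orP[] exy /negPf nxy].
- by rewrite (bigD1 (x, y)) //= nxy mul0r.
- by rewrite (bigD1 (y, x)) //= edge_sym nxy mul0r.
Qed.

Let o0 : 'I_3 := Ordinal (isT : 0 < 3)%N.
Let o1 : 'I_3 := Ordinal (isT : 1 < 3)%N.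
Let o2 : 'I_3 := Ordinal (isT : 2 < 3)%N.

Lemma ord3P (P : 'I_3 -> Prop) : P o0 -> P o1 -> P o2 -> forall i, P i.
Proof.
move=> P0 P1 P2 [[|[|[|i]]] hi] //;
  [move: P0|move: P1|move: P2]; congr P; exact: val_inj.
Qed.

Definition tri (T : Type) (a b c : T) (i : 'I_3) : T :=
  match val i with 0%N => a | 1%N => b | _ => c end.

(** The nesting puts the second and third parts together as the pair that [biclique] expects. *)
Definition glue t (q : {ffun 'I_t -> V} * ({ffun 'I_t -> V} * {ffun 'I_t -> V})) :
    {ffun 'I_3 * 'I_t -> V} :=
  [ffun u => tri (q.1 u.2) (q.2.1 u.2) (q.2.2 u.2) u.1].

Lemma glue_bij t : bijective (@glue t).
Proof.
exists (fun f : {ffun 'I_3 * 'I_t -> V} => ([ffun i => f (o0, i)],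
    ([ffun i => f (o1, i)], [ffun i => f (o2, i)]))).
  by case=> x [y z]; congr (_, (_, _)); apply/ffunP => i; rewrite !ffunE.
move=> f; apply/ffunP => -[i a]; rewrite ffunE /=.
by elim/ord3P: i; rewrite /tri /= ffunE.
Qed.

Lemma prod_blowup t (e : rel 'I_3) (q : 'I_3 -> 'I_3 -> R) :
  \prod_(p : ('I_3 * 'I_t) * ('I_3 * 'I_t) | e p.1.1 p.2.1) q p.1.1 p.2.1 =
  (\prod_(p : 'I_3 * 'I_3 | e p.1 p.2) q p.1 p.2) ^+ (t ^ 2).
Proof.
pose h (p : ('I_3 * 'I_3) * ('I_t * 'I_t)) := ((p.1.1, p.2.1), (p.1.2, p.2.2)).
have h_bij : bijective h.
  by exists (fun p => ((p.1.1, p.2.1), (p.1.2, p.2.2))); case=> [[? ?] [? ?]].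
rewrite (reindex h) /=; last exact: onW_bij.
transitivity (\prod_(p : 'I_3 * 'I_3 | e p.1 p.2) \prod_(r : 'I_t * 'I_t) q p.1 p.2).
  rewrite (pair_big (fun p : 'I_3 * 'I_3 => e p.1 p.2) xpredT
    (fun p (_ : 'I_t * 'I_t) => q p.1 p.2)) /=.
  by apply: eq_bigl => r; rewrite andbT.
rewrite -prodrXl; apply: eq_bigr => p _.
by rewrite prodr_const card_prod card_ord mulnn.
Qed.

(** Keep only the maps whose pairs are all good; each triangle edge [(i, j)] becomes [t ^ 2] pairs,
    of weight at least [q i j] each. *)
Lemma hom_sum_blowup t (W : V * V -> R) (q : 'I_3 -> 'I_3 -> R)
    (g : 'I_3 -> 'I_3 -> rel V) (S : 'I_3 -> {set V}) :
  (forall p, 0 <= W p) -> (forall i j, 0 <= q i j) ->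
  (forall i j u v, g i j u v -> q i j <= W (u, v)) ->
  (\prod_(p : 'I_3 * 'I_3 | (p.1 < p.2)%N) q p.1 p.2) ^+ (t ^ 2) *
    extensions R (S o0) (g o0 o1) (g o0 o2) (g o1 o2) t t (S o1) (S o2)
  <= hom_sum (fun u v : 'I_3 * 'I_t => (u.1 < v.1)%N) W.
Proof.
move=> W0 q0 gq; rewrite /hom_sum (reindex (@glue t)) /=; last exact/onW_bij/glue_bij.
rewrite -(prod_blowup t (fun i j => (i < j)%N) q).
set K := \prod_(_ | _) _.
rewrite -(pair_bigA _ (fun x p => \prod_(u : ('I_3 * 'I_t) * ('I_3 * 'I_t) |
  (u.1.1 < u.2.1)%N) W (glue (x, p) u.1, glue (x, p) u.2))) /=.
rewrite exchange_big /extensions mulr_sumr [leLHS]big_mkcond /=.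
have prod0 x p : 0 <= \prod_(u : ('I_3 * 'I_t) * ('I_3 * 'I_t) | (u.1.1 < u.2.1)%N)
    W (glue (x, p) u.1, glue (x, p) u.2) by exact: prodr_ge0.
apply: ler_sum => p _; case: ifP => [bp|_]; last exact: sumr_ge0.
set X := common _ _ _ p.
have -> : #|X|%:R ^+ t = \sum_(x : {ffun 'I_t -> V} | x \in ffun_on (mem X)) 1 :> R.
  by rewrite sumr_const card_ffun_on card_ord natrX.
rewrite mulr_sumr mulr1 [leLHS]big_mkcond; apply: ler_sum => x _.
case: ifP => [/ffun_onP xX|_]; last exact: prod0.
apply: ler_prod => -[[i a] [j b]] /= ij; rewrite q0 /= !ffunE /=.
have := xX a; rewrite !inE => /andP[_ /forallP/(_ b)/andP[g1 g2]].
have /and3P[_ _ /forallP/(_ a)/forallP/(_ b) g3] := bp.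
by elim/ord3P: i ij; elim/ord3P: j => // _; exact: gq.
Qed.

End Blowup.

(** * Parameters and conclusion *)

Lemma bernoulli (R : realFieldType) (x : R) n : 0 <= x <= 1 -> 1 - n%:R * x <= (1 - x) ^+ n.
Proof.
move=> /andP[x0 x1]; elim: n => [|n IH]; first by rewrite expr0 mul0r subr0.
rewrite exprS; apply: le_trans (ler_wpM2l (_ : 0 <= 1 - x) IH); last by lra.
have : 0 <= n%:R * x ^+ 2 by rewrite mulr_ge0 ?sqr_ge0.
by rewrite -natr1; lra.
Qed.

Lemma exists_small_pow (R : realType) (r x : R) : 0 < r < 1 -> 0 < x ->
  exists n, (2 <= n)%N && (r ^+ n <= x).
Proof.
move=> /andP[r0 r1] x0.
have bound n : r ^+ n * (1 + n%:R * (1 - r)) <= 1.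
  elim: n => [|n IH]; first by rewrite expr0 mul0r addr0 mulr1.
  apply: le_trans IH; rewrite exprSr -mulrA ler_wpM2l ?exprn_ge0 ?(ltW r0) //.
  rewrite -subr_ge0 -natr1.
  have -> : 1 + n%:R * (1 - r) - r * (1 + (n%:R + 1) * (1 - r)) =
    (1 - r) ^+ 2 * (1 + n%:R) by ring.
  by rewrite mulr_ge0 ?sqr_ge0 // addr_ge0.
pose n := (Num.truncn ((x * (1 - r))^-1)).+2.
exists n; rewrite /=.
have d0 : 0 < x * (1 - r) by rewrite mulr_gt0 // subr_gt0.
have nx : 1 <= n%:R * (x * (1 - r)).
  rewrite -ler_pdivrMr // div1r; apply: ltW; apply: lt_trans (truncnS_gt _) _.
  by rewrite ltr_nat.
have rn : 0 <= r ^+ n by rewrite exprn_ge0 // ltW.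
have := bound n; rewrite mulrDr mulr1 => le1.
have := ler_wpM2l rn nx => le2; have := ler_wpM2l (ltW x0) le1 => le3.
have : 0 <= x * r ^+ n by rewrite mulr_ge0 // ltW.
by lra.
Qed.

(* A factor [r ^ (t ^ 2)] is lost four times: in the choice of the blocks ([rho]), in
   the discount [1 - k] on the pair densities, in [near_complete] ([56 * tau]) and
   for the volume of the blocks ([r ^ t <= v ^ 3 / 16]). *)
Lemma blowup_count (R : realType) (gamma r : R) (slack := (1 - r) * gamma)
    (tau := (1 - r) / 56) (k := (1 - r) / 9) (rho := r * gamma)
    (L := (tau ^+ 4 * (k * rho) ^+ 2)^-1) (s := slack / 45)
    (zeta := (slack / 45) / (s^-1 + L))
    (V : finType) (w : V * V -> R) (c c' : V -> nat) m t (eps v : R) :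
  0 < gamma < 1 -> 0 < r < 1 ->
  (0 < #|V|)%N -> (forall p, 0 <= w p <= 1) -> (forall x, (c x < m)%N) ->
  (forall x y, c' x = c' y -> c x = c y) -> (2 <= t)%N ->
  0 < v -> m%:R * v <= slack / 15 -> r ^+ t <= v ^+ 3 / 16 ->
  0 <= eps <= slack / 45 -> eps * (t%:R ^+ 2 * 9) <= (r ^+ 4 * gamma) ^+ (t ^ 2) ->
  cut_close eps w (cond_exp (box c') w) ->
  energy (box c') w <= energy (box c) w + zeta * #|V|%:R ^+ 2 ->
  gamma <= hom_sum (fun i j : 'I_3 => (i < j)%N) w / #|V|%:R ^+ 3 ->
  (r ^+ 4 * gamma) ^+ (t ^ 2) * #|V|%:R ^+ (3 * t) <=
    hom_sum (fun u v : 'I_3 * 'I_t => (u.1 < v.1)%N) w.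
Proof.
move=> /andP[g0 g1] /andP[r0 r1] V0 w01 cm ref t2 v0 mv rt /andP[eps0 eps1] epst cut en dens.
have n0 : 0 < #|V|%:R :> R by rewrite ltr0n.
pose o0 : 'I_3 := Ordinal (isT : 0 < 3)%N.
pose o1 : 'I_3 := Ordinal (isT : 1 < 3)%N.
pose o2 : 'I_3 := Ordinal (isT : 2 < 3)%N.
have slack0 : 0 < slack by rewrite mulr_gt0 // subr_gt0.
have tau0 : 0 < tau by rewrite divr_gt0 // subr_gt0.
have k0 : 0 < k by rewrite divr_gt0 // subr_gt0.
have rho0 : 0 < rho by rewrite mulr_gt0.
have L0 : 0 < L by rewrite invr_gt0 mulr_gt0 // exprn_gt0 // mulr_gt0.
have s0 : 0 < s by rewrite divr_gt0.
have sL0 : 0 < s^-1 + L by rewrite addr_gt0 // invr_gt0.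
have zeta0 : 0 < zeta by rewrite !divr_gt0.
have asym3 (i j : 'I_3) : (i < j)%N -> ~~ (j < i)%N by rewrite -leqNgt; exact: ltnW.
have [|f [fv fD fW]] := select_blocks V0 asym3 w01 cm ref s0 L0 (ltW v0) (ltW rho0)
    (ltW zeta0) eps0 cut en.
  rewrite card_ord; apply: lt_le_trans dens.
  (* The three edge errors cost at most [9 * 3 / 45] of [slack] and the small blocks [3 / 15],
     together [4 / 5] of [slack = gamma - rho]. *)
  have -> : zeta * (s^-1 + L) = slack / 45 by rewrite divfK ?gt_eqF.
  have : slack = gamma - rho by rewrite /slack /rho; ring.
  move: mv eps1 slack0; rewrite /s; clearbody slack; clear; lra.
set W' := cond_exp (box c') w in cut fD *; set W := cond_exp (box c) w in fD fW *.
have W'01 p : 0 <= W' p <= 1 by exact: cond_exp_bounds.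
have W01 p : 0 <= W p <= 1 by exact: cond_exp_bounds.
pose S i := [set u | c u == c (f i)].
pose q i j := (1 - k) * W (f i, f j).
have k1 : 9 * k = 1 - r by rewrite /k; field.
have k01 : 0 <= 1 - k by lra.
have q0 i j : 0 <= q i j by rewrite mulr_ge0 //; case/andP: (W01 (f i, f j)).
pose g i j : rel V := fun u v => q i j <= W' (u, v).
have Sv i : v * #|V|%:R <= #|S i|%:R.
  by apply: le_trans (fv i) _; rewrite ler_nat; apply/subset_leq_card/subsetP => u; rewrite !inE.
have S0 i : S i != set0.
  by rewrite -card_gt0 -(ltr0n R); apply: lt_le_trans (Sv i); rewrite mulr_gt0.
have rhoW (i j : 'I_3) : (i < j)%N -> rho <= W (f i, f j).
  move=> ij; apply: le_trans fW _; rewrite (bigD1 (i, j)) //=.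
  rewrite -[leRHS]mulr1 ler_wpM2l //; first by case/andP: (W01 (f i, f j)).
  by have /andP[] := prod_bounds (index_enum ('I_3 * 'I_3)%type)
    (fun p => (p.1 < p.2)%N && (p != (i, j))) (fun p => W01 (f p.1, f p.2)).
have bad (i j : 'I_3) : (i < j)%N -> nonadj R (g i j) (S i) (S j) <= tau ^+ 4 * area R (S i) (S j).
  move=> ij; apply: few_low_pairs k0 rho0 (rhoW _ _ ij) _.
    by move=> p p'; exact: cond_exp_const.
  have Li0 : 0 < tau ^+ 4 * (k * rho) ^+ 2.
    by rewrite -invr_gt0.
  by have := fD _ _ ij; rewrite /L [X in X <= 1]mulrC ler_pdivrMr // mul1r.
have t0 : (0 < t)%N by apply: leq_trans t2.
have tau56 : 1 - 56 * tau = r by rewrite /tau; field.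
have tau1 : 56 * tau <= 1 by lra.
have NC := near_complete tau0 tau1 (S0 o0) (S0 o1) (S0 o2) t0
  (bad o0 o1 isT) (bad o0 o2 isT) (bad o1 o2 isT).
rewrite tau56 in NC.
have W'0 p : 0 <= W' p by case/andP: (W'01 p).
have HB := @hom_sum_blowup R V t W' q g S W'0 q0 (fun _ _ _ _ h => h).
(* At most nine pairs carry the discount [1 - k], and [(1 - k) ^ 9 >= 1 - 9 * k = r]. *)
have Pq : r * rho <= \prod_(p : 'I_3 * 'I_3 | (p.1 < p.2)%N) q p.1 p.2.
  rewrite big_split /= prodr_const ler_pM ?(ltW r0) ?(ltW rho0) //.
  apply: (@le_trans _ _ ((1 - k) ^+ 9)).
    by apply: le_trans (bernoulli _ _); lra.
  apply: ler_wiXn2l => //; first lra.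
  by rewrite -[9%N]/(3 * 3)%N -[X in (X * X)%N](card_ord 3) -card_prod max_card.
set X := (r ^+ 4 * gamma) ^+ (t ^ 2) in epst *.
have XE : X = (r ^+ 4 * gamma) ^+ (t ^ 2) by [].
have X0 : 0 <= X by rewrite exprn_ge0 // mulr_ge0 ?exprn_ge0 // ltW.
(* The factor 2 leaves room for going back from [W'] to [w], which costs at most
   [X * #|V| ^ (3 * t)]. *)
have main : 2 * X * #|V|%:R ^+ (3 * t) <=
    hom_sum (fun u v : 'I_3 * 'I_t => (u.1 < v.1)%N) W'.
  apply: le_trans HB.
  apply: le_trans (ler_pM _ _ (_ : (r * rho) ^+ (t ^ 2) <= _) NC); first last.
  - rewrite lerXn2r ?nnegrE ?(le_trans _ Pq) //; by rewrite mulr_ge0 ?(ltW r0) ?(ltW rho0).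
  - by rewrite mulr_ge0 ?exprn_ge0 ?(ltW r0) // divr_ge0 // !mulr_ge0.
  - by rewrite exprn_ge0 // mulr_ge0 ?(ltW r0) ?(ltW rho0).
  have vol : 2 * r ^+ t * #|V|%:R ^+ 3 <= #|S o0|%:R * area R (S o1) (S o2) / 8.
    rewrite ler_pdivlMr // /area.
    have v3 : (v * #|V|%:R) * ((v * #|V|%:R) * (v * #|V|%:R)) <=
        #|S o0|%:R * (#|S o1|%:R * #|S o2|%:R).
      by rewrite !ler_pM // ?mulr_ge0 // ltW.
    apply: le_trans v3; have := ler_wpM2r (ltW (_ : 0 < #|V|%:R ^+ 3 :> R)) rt.
    by rewrite exprn_gt0 // => /(_ isT); lra.
  have pw2 : 2 <= 2 ^+ t :> R by rewrite -natrX ler_nat -{1}(expn1 2) leq_exp2l.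
  have -> : 2 * X * #|V|%:R ^+ (3 * t) =
      (r * rho) ^+ (t ^ 2) * (2 * (r ^+ t * #|V|%:R ^+ 3) ^+ t * r ^+ (t ^ 2)).
    by rewrite XE /rho exprM !exprMn -!exprM mulnn; ring.
  rewrite ler_wpM2l ?exprn_ge0 ?mulr_ge0 ?(ltW r0) ?(ltW g0) //.
  rewrite ler_wpM2r ?exprn_ge0 ?(ltW r0) //.
  apply: (@le_trans _ _ ((2 * r ^+ t * #|V|%:R ^+ 3) ^+ t)).
    rewrite -mulrA [leRHS]exprMn ler_wpM2r // exprn_ge0 // mulr_ge0 // exprn_ge0 //.
    exact: ltW.
  rewrite lerXn2r ?nnegrE ?(le_trans _ vol) //;
    by rewrite !mulr_ge0 ?exprn_ge0 // ltW.
have asymt (a b : 'I_3 * 'I_t) : (a.1 < b.1)%N -> ~~ (b.1 < a.1)%N.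
  by rewrite -leqNgt; exact: ltnW.
rewrite cut_closeC in cut.
have := hom_sum_cut_close V0 cut W'01 w01 asymt.
rewrite card_prod !card_ord natrM => close.
have N0 : 0 < #|V|%:R ^+ (3 * t) :> R by rewrite exprn_gt0.
have := ler_wpM2r (ltW N0) epst.
move: main close.
move: (hom_sum _ W') (hom_sum _ w) (#|V|%:R ^+ (3 * t)) => A B N.
lra.
Qed.

Theorem theorem1 (R : realType) (gamma delta : R)
    (hgamma : 0 < gamma < 1) (hdelta : 0 < delta < 1) :
  exists N T : nat, forall G : sgraph,
    (N <= #|G|)%N ->
    density R (complete_graph 3) G = gamma ->
    exists t : nat, (2 <= t <= T)%N /\
      gamma `^ ((1 + delta) * t%:R ^+ 2)
        <= density R (complete_multipartite 3 t) G.
Proof.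
have /andP[g0 g1] := hgamma; have /andP[d0 d1] := hdelta.
pose b := gamma `^ delta.
have b0 : 0 < b by exact: powR_gt0.
have b1 : b < 1.
  have := @gt0_ltr_powR R delta d0 gamma 1; rewrite !nnegrE powR1.
  by apply=> //; exact: ltW.
(* By Bernoulli [r ^ 4 >= b], so the four lost factors fit into [gamma ^ delta]. *)
pose r := 1 - (1 - b) / 4.
have r01 : 0 < r < 1 by rewrite /r; apply/andP; split; lra.
have /andP[r0 r1] := r01.
have br : b <= r ^+ 4.
  by apply: le_trans (bernoulli _ _); lra.
pose slack := (1 - r) * gamma.
have slack0 : 0 < slack by rewrite mulr_gt0 // subr_gt0.
(* The successor keeps the denominator positive at [m = 0]. *)
pose v m : R := slack / 15 / m.+1%:R.
have v0 m : 0 < v m by rewrite !divr_gt0.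
have [tf tfP] : exists tf : nat -> nat, forall m,
    (2 <= tf m)%N && (r ^+ tf m <= v m ^+ 3 / 16).
  have ex m : exists n, (2 <= n)%N && (r ^+ n <= v m ^+ 3 / 16).
    by apply: exists_small_pow r01 _; rewrite divr_gt0 // exprn_gt0.
  by exists (fun m => ex_minn (ex m)) => m; case: ex_minnP.
pose X m := (r ^+ 4 * gamma) ^+ (tf m ^ 2).
have X0 m : 0 < X m by rewrite exprn_gt0 // mulr_gt0 // exprn_gt0.
(* Block volume, [t] and then the precision all depend on the coarse size [m] alone, as
   [strong_regularity] requires. *)
pose eps m := Num.min (slack / 45) (X m / ((tf m)%:R ^+ 2 * 9)).
have tf0 m : 0 < (tf m)%:R ^+ 2 * 9 :> R.
  rewrite mulr_gt0 // exprn_gt0 // ltr0n.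
  by have /andP[t2 _] := tfP m; apply: leq_trans t2.
have eps0 m : 0 < eps m by rewrite lt_min !divr_gt0.
pose tau := (1 - r) / 56; pose k := (1 - r) / 9; pose rho := r * gamma.
pose L := (tau ^+ 4 * (k * rho) ^+ 2)^-1; pose s := slack / 45.
pose zeta := (slack / 45) / (s^-1 + L).
have zeta0 : 0 < zeta.
  have q0 : 0 < 1 - r by rewrite subr_gt0.
  have tau0 : 0 < tau by rewrite divr_gt0.
  have k0 : 0 < k by rewrite divr_gt0.
  have rho0 : 0 < rho by rewrite mulr_gt0.
  have s0 : 0 < s by rewrite divr_gt0.
  have L0 : 0 < L by rewrite invr_gt0 mulr_gt0 // exprn_gt0 // mulr_gt0.
  have sL0 : 0 < s^-1 + L by rewrite addr_gt0 // invr_gt0.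
  by rewrite !divr_gt0.
have [M HM] := strong_regularity zeta0 eps0.
(* The blowup size is [tf m] for the coarse size [m <= M] that regularity returns. *)
exists 1%N, (\max_(m < M.+1) tf m) => G G0 dens.
pose w (p : G * G) : R := (edge p.1 p.2)%:R.
have w01 p : 0 <= w p <= 1 by rewrite /w; case: edge; rewrite ?lexx ler01.
have [m [c [c' [mM cm ref cut en]]]] := HM G w G0 w01.
have /andP[t2 rt] := tfP m; exists (tf m); split.
  by rewrite t2 /= (leq_bigmax (Ordinal (mM : (m < M.+1)%N))).
have n0 : 0 < #|G|%:R :> R by rewrite ltr0n.
have dens3 : gamma <= hom_sum (fun i j : 'I_3 => (i < j)%N) w / #|G|%:R ^+ 3.
  rewrite -dens /density (hom_count_sum R G (e := fun i j : complete_graph 3 => (i < j)%N)).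
    by rewrite card_ord natrX.
  by move=> i j /=; rewrite -neq_ltn.
have mv : m%:R * v m <= slack / 15.
  rewrite /v mulrCA -[leRHS]mulr1 ler_wpM2l ?divr_ge0 ?(ltW slack0) //.
  by rewrite ler_pdivrMr // mul1r ler_nat.
have epsP : 0 <= eps m <= slack / 45 by rewrite (ltW (eps0 m)) ge_min lexx.
have epst : eps m * ((tf m)%:R ^+ 2 * 9) <= X m.
  by rewrite -ler_pdivlMr // ge_min lexx orbT.
have count := blowup_count hgamma r01 G0 w01 cm ref t2 (v0 m) mv rt epsP epst cut en dens3.
rewrite /density (hom_count_sum R G
  (e := fun a b : complete_multipartite 3 (tf m) => (a.1 < b.1)%N)); last first.
  by move=> i j /=; rewrite -neq_ltn.
rewrite card_prod !card_ord natrX ler_pdivlMr ?exprn_gt0 //.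
apply: le_trans count; rewrite ler_pM2r ?exprn_gt0 //.
(* Reduces to comparing bases: [gamma * gamma ^ delta] against [r ^ 4 * gamma]. *)
rewrite -natrX powRrM powR_mulrn ?powR_ge0 //.
rewrite lerXn2r ?nnegrE ?powR_ge0 // ?mulr_ge0 ?exprn_ge0 ?(ltW r0) ?(ltW g0) //.
rewrite powRD ?(gt_eqF g0) ?implybT // powRr1 ?(ltW g0) // mulrC.
by rewrite ler_wpM2r // ltW.
Qed.
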